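(* Let $f$ be a conservative twist map of $\mathbb{A}$ and let $\mu$ be a Borel probability measure that is invariant and ergodic for $f$, with compact support and such that $\mathrm{supp}\,\mu\subset\mathrm{Green}(f)$. Then $d=\dim(G_-\cap G_+)$ is constant $\mu$-almost everywhere and: (i) if $d=0$, the measure $\mu$ is hyperbolic with Lyapunov exponents $-\lambda(\mu)<\lambda(\mu)$ given by $$\lambda(\mu)=\frac12\int\log\left(\frac{s_+-s_{-1}}{s_--s_{-1}}\right)d\mu=\frac12\int\log\left(1+\frac{s_+-s_-}{s_--s_{-1}}\right)d\mu;$$ (ii) if $d=1$, the Lyapunov exponents of $\mu$ are zero.
   Context: $\mathbb{T}=\mathbb{R}/\mathbb{Z}$, $\mathbb{A}=\mathbb{T}\times\mathbb{R}$ with coordinates $(\theta,r)$, $\pi(\theta,r)=\theta$, $\lambda=r\,d\theta$. A conservative twist map is a $C^1$-diffeomorphism $f:\mathbb{A}\to\mathbb{A}$ that is isotopic to the identity, such that there is $\varepsilon>0$ with $\varepsilon<D(\pi\circ f)(x)(0,1)<1/\varepsilon$ for all $x\in\mathbb{A}$ (positive twist), and such that the 1-form $f^*\lambda-\lambda$ is exact. $V(x)=\{0\}\times\mathbb{R}\subset T_x\mathbb{A}$; for $k\in\mathbb{Z}\setminus\{0\}$, $G_k(x)=Df^k(f^{-k}x)V(f^{-k}x)$; when $G_k(x)$ is transverse to $V(x)$, its slope is $s_k(x)$, i.e. $G_k(x)=\{(\delta\theta,s_k(x)\delta\theta):\delta\theta\in\mathbb{R}\}$. $\mathrm{Green}(f)$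 is the set of $x\in\mathbb{A}$ such that at every point $y$ of the orbit of $x$ all these slopes are defined and, for all $n\ge1$, $s_{-n}(y)<s_{-n-1}(y)<s_{n+1}(y)<s_n(y)$. For $x\in\mathrm{Green}(f)$, $s_+(x)=\lim_{n\to+\infty}s_n(x)$, $s_-(x)=\lim_{n\to+\infty}s_{-n}(x)$, and the Green bundles $G_+(x),G_-(x)\subset T_x\mathbb{A}$ are the lines with slopes $s_+(x)$, $s_-(x)$. An ergodic measure is hyperbolic if it has two Lyapunov exponents $\lambda_1<0<\lambda_2$. *)

(* Defs.v *)
From HB Require Import structures.
From mathcomp Require Import all_boot all_order all_algebra.
From mathcomp Require Import archimedean generic_quotient.
From mathcomp Require Import all_classical all_reals all_analysis.

Set Implicit Arguments.
Unset Strict Implicit.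
Unset Printing Implicit Defensive.

Import Order.TTheory GRing.Theory Num.Theory.
Import numFieldNormedType.Exports.

Local Open Scope classical_set_scope.
Local Open Scope ring_scope.
Local Open Scope quotient_scope.

Section circle.
Context (R : realType).

Definition eqmodZ (a b : R) : bool := (a - b) \is a Num.int.

Lemma eqmodZ_refl : reflexive eqmodZ.
Proof. by move=> a; rewrite /eqmodZ subrr rpred0. Qed.

Lemma eqmodZ_sym : symmetric eqmodZ.
Proof. by move=> a b; rewrite /eqmodZ -opprB rpredN. Qed.

Lemma eqmodZ_trans : transitive eqmodZ.
Proof.
by move=> b a c ab bc; rewrite /eqmodZ -(subrK b a) -addrA rpredD.
Qed.

Canonical eqmodZ_equiv := EquivRel eqmodZ eqmodZ_refl eqmodZ_sym eqmodZ_trans.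

Definition circle : Type := quotient_topology {eq_quot eqmodZ}.
HB.instance Definition _ :=
  PointedTopological.copy circle (quotient_topology {eq_quot eqmodZ}).

Definition to_circle (a : R) : circle := \pi_{eq_quot eqmodZ} a.

Definition circle_shift (t : circle) (a : R) : circle :=
  to_circle (repr (t : {eq_quot eqmodZ}) + a).

End circle.

Definition annulus (R : realType) : Type := (circle R * R)%type.
HB.instance Definition _ (R : realType) :=
  Topological.copy (annulus R) (circle R * R)%type.
HB.instance Definition _ (R : realType) :=
  Pointed.copy (annulus R) (circle R * R)%type.

Definition borel_annulus (R : realType) := g_sigma_algebraType (@open (annulus R)).

Section annulus_calculus.
Context (R : realType).
Notation A := (annulus R).

(* Every tangent space of the annulus is identified with the space of row
   vectors (dtheta, dr) : 'rV[R]_2 by the chart v |-> annulus_shift x v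
   around x. Linear maps are 2 x 2 matrices acting on the right, as the library's
   Jacobian 'J, and linear subspaces are row spaces of matrices. *)
Definition annulus_shift (x : A) (v : 'rV[R]_2) : A :=
  (circle_shift x.1 (v 0 0), x.2 + v 0 1).

(* In the charts around x and f x, f reads phi, whose Jacobian at 0 is L. *)
Definition has_differential (f : A -> A) (x : A) (L : 'M[R]_2) : Prop :=
  exists phi : 'rV[R]_2 -> 'rV[R]_2,
    [/\ phi 0 = 0,
        \forall v \near (0 : 'rV[R]_2), f (annulus_shift x v) = annulus_shift (f x) (phi v),
        differentiable phi (0 : 'rV[R]_2)
      & 'J phi 0 = L].

Definition Df (f : A -> A) (x : A) : 'M[R]_2 := xget 0 [set L | has_differential f x L].

Definition C1 (f : A -> A) : Prop :=
  (forall x, exists L, has_differential f x L) /\ continuous (Df f).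

Definition inverse_map (f : A -> A) : A -> A := pinv setT f.

Definition C1_diffeomorphism (f : A -> A) : Prop :=
  [/\ bijective f, C1 f & C1 (inverse_map f)].

Definition homeomorphism (h : A -> A) : Prop :=
  [/\ bijective h, continuous h & continuous (inverse_map h)].

Definition isotopic_to_id (f : A -> A) : Prop :=
  exists H : R -> A -> A,
    [/\ {within `[0, 1]%classic `*` [set: A], continuous (fun p : R * A => H p.1 p.2)},
        forall t, 0 <= t <= 1 -> homeomorphism (H t),
        H 0 = id
      & H 1 = f].

Definition vert : 'rV[R]_2 := delta_mx 0 1.

(* The value at (x, v) of the 1-form f^* lambda - lambda, lambda = r dtheta. *)
Definition pullback_liouville_diff (f : A -> A) (x : A) (v : 'rV[R]_2) : R :=
  (f x).2 * (v *m Df f x) 0 0 - x.2 * v 0 0.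

Definition exact_form (alpha : A -> 'rV[R]_2 -> R) : Prop :=
  exists S : A -> R, forall x,
    differentiable (fun v => S (annulus_shift x v)) (0 : 'rV[R]_2) /\
    forall v, 'd (fun v => S (annulus_shift x v)) (0 : 'rV[R]_2) v = alpha x v.

(* (vert *m Df f x) 0 0 is D(pi o f)(x)(0, 1). *)
Definition positive_twist (f : A -> A) : Prop :=
  exists2 e : R, 0 < e & forall x, e < (vert *m Df f x) 0 0 < 1 / e.

Definition conservative_twist_map (f : A -> A) : Prop :=
  [/\ C1_diffeomorphism f, isotopic_to_id f, positive_twist f
    & exact_form (pullback_liouville_diff f)].

Definition iterz (f : A -> A) (k : int) (x : A) : A :=
  match k with
  | Posz n => iter n f x
  | Negz n => iter n.+1 (inverse_map f) x
  end.

(* A row vector spanning G_k(x) = Df^k(f^-k x) V(f^-k x). *)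
Definition Gk (f : A -> A) (k : int) (x : A) : 'rV[R]_2 :=
  vert *m Df (iterz f k) (iterz f (- k) x).

(* A row vector spanning the line {(dtheta, s dtheta)}. *)
Definition line (s : R) : 'rV[R]_2 := \row_(i < 2) (if i == 0 then 1 else s).

Definition transverse (G H : 'rV[R]_2) : bool := row_full (G + H)%MS.

Definition slope (f : A -> A) (k : int) (x : A) : R :=
  xget 0 [set s : R | (Gk f k x == line s)%MS].

Definition Green (f : A -> A) : set A :=
  [set x | forall j : int, let y := iterz f j x in
    (forall k : int, k != 0 -> transverse (Gk f k y) vert) /\
    (forall n : nat, (1 <= n)%N ->
      [/\ slope f (- n%:Z) y < slope f (- n.+1%:Z) y,
          slope f (- n.+1%:Z) y < slope f n.+1%:Z y
        & slope f n.+1%:Z y < slope f n%:Z y])].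

Definition s_plus (f : A -> A) (x : A) : R :=
  lim (slope f n%:Z x @[n --> \oo]).

Definition s_minus (f : A -> A) (x : A) : R :=
  lim (slope f (- n%:Z) x @[n --> \oo]).

Definition G_plus (f : A -> A) (x : A) : 'rV[R]_2 := line (s_plus f x).
Definition G_minus (f : A -> A) (x : A) : 'rV[R]_2 := line (s_minus f x).

Definition green_dim (f : A -> A) (x : A) : nat :=
  \rank (G_minus f x :&: G_plus f x)%MS.

Section measures.
Context (f : A -> A) (mu : probability (borel_annulus R) R).

Definition invariant_measure : Prop :=
  forall B : set (borel_annulus R), measurable B -> mu (f @^-1` B) = mu B.

Definition ergodic_measure : Prop :=
  forall B : set (borel_annulus R), measurable B -> f @^-1` B = B ->
    mu B = 0%E \/ mu B = 1%E.

Definition measure_supp : set A :=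
  [set x | forall U : set A, open U -> U x -> (0 < mu U)%E].

Definition growth_rate (x : A) (v : 'rV[R]_2) (l : R) : Prop :=
  (n%:R^-1 * ln `|v *m Df (iterz f n%:Z) x| @[n --> \oo] --> l) /\
  (- n%:R^-1 * ln `|v *m Df (iterz f (- n%:Z)) x| @[n --> \oo] --> l).

(* The elements of L are the distinct Lyapunov exponents of mu: at mu-almost
   every x the tangent space is the direct sum of nonzero Oseledets spaces E l,
   l in L, on which the growth rate, both in the future and in the past,
   is l. *)
Definition lyapunov_exponents (L : seq R) : Prop :=
  uniq L /\
  {ae mu, forall x, exists E : R -> 'M[R]_2,
    [/\ forall l, l \in L -> E l != 0,
        (\sum_(l <- L) E l :=: 1%:M)%MS,
        mxdirect (\sum_(l <- L) E l)%MS
      & forall l (v : 'rV[R]_2), l \in L -> (v <= E l)%MS -> v != 0 ->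
          growth_rate x v l]}.

Definition hyperbolic : Prop :=
  exists l1 l2 : R, l1 < 0 < l2 /\ lyapunov_exponents [:: l1; l2].

End measures.
End annulus_calculus.

(* Main.v *)
(* Let s be one of the two Green slopes: the line of slope s is Df-invariant and
   is stretched by the factor p = b (s - s_(-1)), where b is the twist, so that
   its growth rates in the past and in the future are the integral of ln p, by
   Birkhoff's theorem for f and for f^(-1).  Exactness of f^* lambda - lambda
   forces det Df = 1, hence vert Df = b (1, s) + p^(-1) vert: in the frame given by
   the invariant line and the vertical, the derivative is triangular.
   If P_n is the product of p along an orbit segment and B_n the off-diagonal entry
   of Df^n, then B_n / P_n = \sum_(i < n) b_i / (P_i P_(i+1)), while
   s - s_(-n) = P_n / B_n because s_(-n) is sent to the vertical by Df^n.  When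
   s_- = s_+ the latter quantity tends to 0, so the sum diverges and the rate of P
   cannot be positive; the same argument for f^(-1) and s_n shows that it cannot be
   negative, and then the triangular form bounds every vector subexponentially.
   When s_- < s_+ almost everywhere, preservation of the area spanned by the two
   invariant lines, whose slopes stay bounded, makes the two rates opposite, and
   their difference is the integral of ln (p_+ / p_-). *)

Require Import Defs.
From HB Require Import structures.
From mathcomp Require Import all_boot all_order all_algebra.
From mathcomp Require Import archimedean generic_quotient ring lra zify.
From mathcomp Require Import all_classical all_reals all_analysis.
From mathcomp Require Import measurable_realfun.

Set Implicit Arguments.
Unset Strict Implicit.
Unset Printing Implicit Defensive.

Import Order.TTheory GRing.Theory Num.Theory.
Import numFieldNormedType.Exports.

Local Open Scope classical_set_scope.
Local Open Scope ring_scope.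

(** * Birkhoff's ergodic theorem for bounded functions *)

(** The Green slopes are limits of continuous functions, hence measurable but possibly
    discontinuous. What tames them is a squeeze: on the support both lie between s_(-2) and s_1,
    which are continuous there, and s_(-2) - s_(-1) is continuous and positive, so compactness keeps
    p away from 0 and from infinity. Birkhoff's theorem is therefore needed for bounded functions
    only, where a maximal argument with dominated convergence suffices. As f is merely C^1, the form
    f^* lambda - lambda cannot be differentiated classically to turn its exactness into det Df = 1;
    a second difference of the primitive replaces the exterior derivative. Ergodicity serves twice:
    it makes the averages constant, and it gives the invariant set where s_- = s_+ measure 0 or 1.
    As the averages are constants, a single generic point decides that they vanish, or that they are
    opposite. That the exponent is nonzero in the second case comes from p_- < p_+ almost
    everywhere: the two means are then strictly ordered, and opposite numbers that are strictly
    ordered are nonzero. *)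

Section bounded_integral.
Context (R : realType) (d : measure_display) (T : measurableType d).
Variable P : probability T R.

Lemma bounded_integrable (g : T -> R) (C : R) :
  measurable_fun setT g -> (forall x, `|g x| <= C) ->
  P.-integrable setT (EFin \o g).
Proof.
move=> mg gC; apply: measurable_bounded_integrable => //.
  by have := @probability_le1 _ _ _ P setT measurableT => /le_lt_trans; apply; rewrite ltry.
exists C; split; first exact: num_real.
by move=> x Cx y _ /=; exact: le_trans (gC y) (ltW Cx).
Qed.

Lemma bounded_dominated_cvg (g_ : (T -> R)^nat) (g : T -> R) (C : R) :
  (forall n, measurable_fun setT (g_ n)) -> measurable_fun setT g ->
  (forall n x, `|g_ n x| <= C) ->
  {ae P, forall x, g_ n x @[n --> \oo] --> g x} ->
  (forall x, `|g x| <= C) ->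
  \int[P]_x (g_ n x) @[n --> \oo] --> \int[P]_x (g x).
Proof.
move=> mg_ mg g_C g_g gC.
have [|||||_ _ h] := @dominated_convergence _ _ _ P setT measurableT
  (fun n x => (g_ n x)%:E) (fun x => (g x)%:E) (fun=> C%:E).
- by move=> n; exact/measurable_EFinP.
- exact/measurable_EFinP.
- by apply: filterS g_g => x h _; apply/fine_cvgP; split; [exact: nearW|exact: h].
- exact: (bounded_integrable (g := cst C) (C := `|C|)).
- by apply: aeW => x n _; rewrite lee_fin.
rewrite /Rintegral; apply: fine_cvg; rewrite fineK//.
exact/integrable_fin_num/(bounded_integrable mg gC).
Qed.
End bounded_integral.

Definition birkhoff_sum (R : realType) (T : Type) (S : T -> T) (g : T -> R)
  (n : nat) (x : T) : R := \sum_(i < n) g (iter i S x).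

Section birkhoff.
Context (R : realType) (d : measure_display) (T : measurableType d).
Variables (P : probability T R) (S : T -> T).
Hypothesis mS : measurable_fun setT S.
Hypothesis Pinv : forall B, measurable B -> P (S @^-1` B) = P B.
Hypothesis Perg : forall B, measurable B -> S @^-1` B = B -> P B = 0%E \/ P B = 1%E.

Lemma invariant_Rintegral (g : T -> R) (C : R) :
  measurable_fun setT g -> (forall x, `|g x| <= C) ->
  \int[P]_x g (S x) = \int[P]_x g x.
Proof.
move=> mg gC; rewrite /Rintegral; congr fine.
have := @integral_pushforward _ _ _ _ _ _ mS P setT (EFin \o g).
rewrite preimage_setT => <- //.
- by apply: eq_measure_integral => A mA _; exact: Pinv.
- exact/measurable_EFinP.
- apply: (@bounded_integrable _ _ _ P (g \o S) C).
    exact: measurableT_comp.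
  by move=> x; exact: gC.
Qed.

Lemma birkhoff_sumSl (g : T -> R) n x :
  birkhoff_sum S g n.+1 x = g x + birkhoff_sum S g n (S x).
Proof.
rewrite /birkhoff_sum big_ord_recl; congr (_ + _).
by apply: eq_bigr => i _; rewrite -iterSr.
Qed.

(** The maximum of the Birkhoff sums of lengths 1 to [n.+1]: a sum of length at least 2 is [g x]
    plus a sum started at [S x]. *)
Fixpoint max_sum (g : T -> R) (n : nat) : T -> R :=
  if n is m.+1 then fun x => g x + Num.max 0 (max_sum g m (S x)) else g.

Lemma max_sum_bound g C n x : (forall x, `|g x| <= C) ->
  `|max_sum g n x| <= C *+ n.+1.
Proof.
move=> gC; elim: n x => [|n IHn] x //=.
rewrite (le_trans (ler_normD _ _))// mulrS lerD//.
rewrite (le_trans _ (IHn (S x)))//.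
by case: (lerP 0 (max_sum g n (S x))) => // h; rewrite normr0.
Qed.

Lemma measurable_max_sum g n :
  measurable_fun setT g -> measurable_fun setT (max_sum g n).
Proof.
move=> mg; elim: n => [|n IHn] //=.
apply: measurable_funD => //.
apply: (@measurable_maxr _ _ _ _ (cst 0)); first exact: measurable_cst.
exact: measurableT_comp.
Qed.

Lemma max_sum_nondecreasing g n x : max_sum g n x <= max_sum g n.+1 x.
Proof.
elim: n x => [|n IHn] x /=; first by rewrite lerDl le_max lexx.
by rewrite lerD2l ge_max !le_max lexx /= (IHn (S x)) orbT.
Qed.

Lemma birkhoff_sum_le_max (g : T -> R) n x : birkhoff_sum S g n.+1 x <= max_sum g n x.
Proof.
elim: n x => [|n IHn] x.
  by rewrite birkhoff_sumSl /birkhoff_sum big_ord0 addr0.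
by rewrite birkhoff_sumSl /= lerD2l le_max IHn orbT.
Qed.

Definition unbounded_max (g : T -> R) : set T :=
  [set x | forall N : nat, exists n, N%:R < max_sum g n x].

Lemma measurable_unbounded_max g :
  measurable_fun setT g -> measurable (unbounded_max g).
Proof.
move=> mg.
have -> : unbounded_max g = \bigcap_N \bigcup_n [set x | N%:R < max_sum g n x].
  apply/seteqP; split => [x xu N _|x xu N].
    by have [n nx] := xu N; exists n.
  by have [n _ nx] := xu N I; exists n.
apply: bigcapT_measurable => N; apply: bigcupT_measurable => n.
have := @measurable_max_sum g n mg measurableT _ (measurable_itv `]N%:R, +oo[).
rewrite setTI; congr (measurable _).
by apply/seteqP; split => x /=; rewrite in_itv /= andbT.
Qed.

(** Sums started at [x] and at [S x] differ by the finite number [g x], so they are unbounded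
    together. The equality of sets is exact, as [Perg] requires. *)
Lemma unbounded_max_invariant g : S @^-1` unbounded_max g = unbounded_max g.
Proof.
apply/seteqP; split => x /= xu N.
  have N_ge0 : 0 <= N%:R + `|g x| by rewrite addr_ge0.
  have [n Mn] := xu (Num.bound (N%:R + `|g x|)); exists n.+1 => /=.
  rewrite -ltrBlDl lt_max; apply/orP; right; apply: lt_trans Mn.
  apply: le_lt_trans (archi_boundP N_ge0); rewrite lerD2l.
  by rewrite -normrN ler_norm.
have N_ge0 : 0 <= N%:R + `|g x| by rewrite addr_ge0.
have [n Mn] := xu (Num.bound (N%:R + `|g x|)); exists n.
have /= := lt_trans (archi_boundP N_ge0)
  (lt_le_trans Mn (max_sum_nondecreasing g n x)).
have gx := ler_norm (g x); have N0 : 0 <= N%:R :> R by [].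
move=> M1n; have : N%:R < Num.max 0 (max_sum g n (S x)) by lra.
by rewrite lt_max ltNge N0.
Qed.

(* Where max_sum is unbounded, max_sum n.+1 - max_sum n \o S decreases to g, while
   its integral is nonnegative because max_sum is nondecreasing in n: if the
   invariant set unbounded_max g had full measure, g would have a nonnegative
   integral. *)
Lemma unbounded_max_null (g : T -> R) (C : R) :
  measurable_fun setT g -> (forall x, `|g x| <= C) -> \int[P]_x g x < 0 ->
  P (unbounded_max g) = 0%E.
Proof.
move=> mg gC g_lt0; have mA := measurable_unbounded_max mg.
have [//|PA1] := Perg mA (unbounded_max_invariant g).
pose M := max_sum g; pose D n x := M n.+1 x - M n (S x).
have mM n : measurable_fun setT (M n) by exact: measurable_max_sum.
have MC n x : `|M n x| <= C *+ n.+1 by exact: max_sum_bound.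
have mMS n : measurable_fun setT (M n \o S) by exact: measurableT_comp.
have mD n : measurable_fun setT (D n) by exact: (measurable_funB (mM n.+1) (mMS n)).
have M_ge n x : g x <= M n x.
  elim: n x => [|n IHn] x; first exact: lexx.
  exact: le_trans (IHn x) (max_sum_nondecreasing _ _ _).
(* The excess of [D n] over [g] is nonnegative, at most [C] because [M n] is at least [g], and zero
   once the maximum at [S x] is nonnegative. *)
have DE n x : D n x = g x + Num.max 0 (- M n (S x)).
  rewrite /D; change (M n.+1 x) with (g x + Num.max 0 (M n (S x))); rewrite -addrA.
  congr (_ + _); case: (lerP 0 (M n (S x))); case: (lerP 0 (- M n (S x))); lra.
have DC n x : `|D n x| <= C + C.
  rewrite DE (le_trans (ler_normD _ _))// lerD// ger0_norm ?le_max ?lexx//.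
  rewrite ge_max (le_trans _ (gC x))//= ?normr_ge0// lerNl.
  have := M_ge n (S x); apply: le_trans.
  by rewrite lerNl (le_trans _ (gC (S x)))// -normrN ler_norm.
have gCC x : `|g x| <= C + C.
  by rewrite (le_trans (gC x))// lerDl (le_trans _ (gC x)).
have aeD : {ae P, forall x, D n x @[n --> \oo] --> g x}.
  exists (~` unbounded_max g); split.
  - exact: measurableC.
  - by rewrite probability_setC// PA1 subee.
  apply: subsetC => x Ax /=.
  have /(_ 0%N) [n0 n0P] : unbounded_max g (S x).
    by have /seteqP[_] := unbounded_max_invariant g; apply.
  apply: (cvg_near_cst (g x)); exists n0 => // n /= n0n.
  have M_n : 0 <= M n (S x).
    have /nondecreasing_seqP := fun n => max_sum_nondecreasing g n (S x).
    by move=> /(_ _ _ n0n); apply: le_trans; exact: ltW.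
  by rewrite DE max_l ?addr0// oppr_le0.
have := bounded_dominated_cvg mD mg DC aeD gCC.
move=> /cvgr_lt /(_ 0 g_lt0) [n0 _ /(_ n0)] /= /(_ (leqnn _)).
rewrite RintegralB//; last 2 first.
- exact: bounded_integrable (MC _).
- exact: (@bounded_integrable _ _ _ P _ _ (mMS n0) (fun x => MC n0 (S x))).
rewrite (invariant_Rintegral (mM n0) (MC n0)) subr_lt0 ltNge le_Rintegral//.
- exact: bounded_integrable (MC _).
- exact: bounded_integrable (MC _).
- by move=> x _; exact: max_sum_nondecreasing.
Qed.

Lemma birkhoff_sum_bounded_above (g : T -> R) (C : R) :
  measurable_fun setT g -> (forall x, `|g x| <= C) -> \int[P]_x g x < 0 ->
  {ae P, forall x, exists c, forall n, birkhoff_sum S g n x <= c}.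
Proof.
move=> mg gC g_lt0; exists (unbounded_max g); split.
- exact: measurable_unbounded_max.
- exact: unbounded_max_null gC g_lt0.
move=> x /= xP N; apply: contrapT => /forallNP MN; apply: xP; exists N%:R.
move=> [|n]; first by rewrite /birkhoff_sum big_ord0.
rewrite (le_trans (birkhoff_sum_le_max _ _ _))// leNgt; exact/negP/MN.
Qed.

(** Subtracting from [g] slightly more than its mean makes the integral negative, hence the Birkhoff
    sums bounded above. Applied to [g] and to [- g], this encloses the sums of length [n] between
    two affine functions of [n] with slopes arbitrarily close to the integral. *)
Theorem birkhoff_ergodic (g : T -> R) (C : R) :
  measurable_fun setT g -> (forall x, `|g x| <= C) ->
  {ae P, forall x, n%:R^-1 * birkhoff_sum S g n x @[n --> \oo] --> \int[P]_x g x}.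
Proof.
move=> mg gC; set I := \int[P]_x g x.
(* The margin runs through the countable family [m.+1%:R^-1], so that one null set serves all
   margins. *)
have upper (h : T -> R) : measurable_fun setT h -> (forall x, `|h x| <= C) ->
    {ae P, forall x (m : nat), exists c, forall n,
       birkhoff_sum S h n x <= n%:R * (\int[P]_x h x + m.+1%:R^-1) + c}.
  move=> mh hC; apply/ae_foralln => m.
  set J := \int[P]_x h x; set e := m.+1%:R^-1.
  have e0 : 0 < e by rewrite invr_gt0.
  have mk : measurable_fun setT (fun x => h x - (J + e)).
    by apply: measurable_funB => //; exact: measurable_cst.
  have kC x : `|h x - (J + e)| <= C + `|J + e|.
    by rewrite (le_trans (ler_normB _ _))// lerD2r.
  have k0 : \int[P]_x (h x - (J + e)) < 0.
    rewrite RintegralB//; last 2 first.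
      exact: bounded_integrable mh hC.
      exact: (@bounded_integrable _ _ _ P (cst (J + e)) `|J + e|).
    by rewrite Rintegral_cst// -/J [X in fine X](@probability_setT _ _ _ P) /=; lra.
  apply: filterS (birkhoff_sum_bounded_above mk kC k0) => x [c xc].
  exists c => n; have := xc n; rewrite /birkhoff_sum sumrB sumr_const card_ord.
  by rewrite -[in X in _ -> X]mulr_natl; lra.
have mNg : measurable_fun setT (fun x => - g x) by exact: measurable_funN.
have NgC x : `|- g x| <= C by rewrite normrN.
have IN : \int[P]_x (- g x) = - I.
  under eq_Rintegral do rewrite -mulN1r.
  by rewrite RintegralZl ?mulN1r//; exact: bounded_integrable gC.
have := upper _ mNg NgC; rewrite IN; apply: filterS2 (upper _ mg gC) => x xu xl.
apply/cvgrPdist_le => e e0.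
have e20 : 0 < e / 2 by rewrite divr_gt0.
have [m _ /(_ m) /= /(_ (leqnn _)) me] := near_infty_natSinv_lt (PosNum e20).
have [c1 xc1] := xu m; rewrite -/I in xc1; have [c2 xc2] := xl m.
have c0 : 0 <= (`|c1| + `|c2|) / (e / 2) by rewrite divr_ge0// ltW.
(* From this rank on, half of [e] absorbs the additive constants [c1] and [c2]; the other half
   absorbs the margin. *)
exists (Num.bound ((`|c1| + `|c2|) / (e / 2))).+1 => // n /= bn.
have n0 : 0 < n%:R :> R by rewrite ltr0n (leq_trans _ bn).
have : (`|c1| + `|c2|) / (e / 2) < n%:R.
  by rewrite (lt_le_trans (archi_boundP c0))// ler_nat ltnW.
rewrite ltr_pdivrMr// => cn.
have -> : I - n%:R^-1 * birkhoff_sum S g n x =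
    n%:R^-1 * (n%:R * I - birkhoff_sum S g n x) by rewrite mulrBr mulKf ?gt_eqF.
rewrite normrM gtr0_norm ?invr_gt0// ler_pdivrMl//.
have := xc1 n; have := xc2 n.
have -> : birkhoff_sum S (fun x => - g x) n x = - birkhoff_sum S g n x.
  by rewrite /birkhoff_sum sumrN.
have := ler_norm c1; have := ler_norm c2.
have : n%:R * m.+1%:R^-1 <= n%:R * (e / 2) by rewrite ler_pM2l// ltW.
have := normr_ge0 c1; have := normr_ge0 c2.
move: cn; rewrite ler_norml !mulrDr mulrN.
set a := n%:R * I; set b := _ / m.+1%:R; set c := n%:R * e.
have -> : n%:R * (e / 2) = c / 2 by rewrite mulrA.
by move=> *; apply/andP; split; lra.
Qed.
End birkhoff.

(** * Differentials in the charts of the annulus *)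

Section shift.
Local Open Scope quotient_scope.
Context (R : realType).
Implicit Types (x y : annulus R) (v w : 'rV[R]_2) (f g : annulus R -> annulus R).

Lemma to_circleP (a b : R) : to_circle a = to_circle b <-> a - b \is a Num.int.
Proof. by split => [/eqmodP//|ab]; apply/eqmodP. Qed.

Lemma to_circle_repr (t : circle R) : to_circle (repr (t : {eq_quot @eqmodZ R})) = t.
Proof. exact: reprK. Qed.

Lemma circle_shift_to_circle (a b : R) : circle_shift (to_circle a) b = to_circle (a + b).
Proof.
apply/to_circleP; rewrite opprD addrACA subrr addr0.
by apply/to_circleP; exact: to_circle_repr.
Qed.

Lemma annulus_shiftD x v w :
  annulus_shift (annulus_shift x v) w = annulus_shift x (v + w).
Proof.
rewrite /annulus_shift /=; congr pair; last by rewrite mxE addrA.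
by rewrite [X in circle_shift X _]/circle_shift circle_shift_to_circle !mxE -addrA.
Qed.

Lemma annulus_shift0 x : annulus_shift x 0 = x.
Proof.
by case: x => t r; rewrite /annulus_shift /circle_shift !mxE !addr0 /= to_circle_repr.
Qed.

Lemma mx_norm_ge_entry v i : `|v 0 i| <= `|v|.
Proof.
rewrite /Num.norm /= mx_normrE.
exact: (@le_bigmax _ _ _ 0 (fun ij : 'I_1 * 'I_2 => `|v ij.1 ij.2|) (0, i)).
Qed.

Lemma row2P v w : v 0 0 = w 0 0 -> v 0 1 = w 0 1 -> v = w.
Proof.
move=> vw0 vw1; apply/rowP => i; case: (unliftP 0 i) => [j ->|->//].
by rewrite (ord1 j) (_ : lift _ _ = 1)//; apply/val_inj.
Qed.

(** Two real angles within 1/2 of 0 differ by less than 1, and 0 is the only integer of absolute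
    value less than 1. *)
Lemma annulus_shift_inj x v w : `|v| < 1 / 2 -> `|w| < 1 / 2 ->
  annulus_shift x v = annulus_shift x w -> v = w.
Proof.
move=> v1 w1 [/to_circleP vw0 /addrI vw1]; apply: row2P => //.
apply/eqP; rewrite -subr_eq0; apply: contraT => vw.
move: vw0; rewrite opprD addrACA subrr add0r => /norm_intr_ge1 => /(_ vw).
have := ler_normB (v 0 0) (w 0 0).
have := mx_norm_ge_entry v 0; have := mx_norm_ge_entry w 0; lra.
Qed.

Lemma continuous_to_circle : continuous (@to_circle R).
Proof. exact: (@pi_continuous R {eq_quot @eqmodZ R}). Qed.

Lemma continuous_annulus_shift x : continuous (annulus_shift x).
Proof.
move=> v; have h i (a : R) : {for v, continuous (fun w : 'rV[R]_2 => a + w 0 i)}.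
  exact: (@cvgD R R _ _ _ (cst a) (fun w : 'rV[R]_2 => w 0 i) _ _ (cvg_cst _)
    (@coord_continuous R 1 2 0 i v)).
have c1 := @continuous_comp _ _ (circle R) _ (@to_circle R) v
  (h 0 (repr (x.1 : {eq_quot @eqmodZ R}))) (@continuous_to_circle _).
move=> A [[P Q] /= [hP hQ] PQA].
have nP : nbhs v (fun w : 'rV[R]_2 => P (circle_shift x.1 (w 0 0))) by exact: c1 hP.
have nQ : nbhs v (fun w : 'rV[R]_2 => Q (x.2 + w 0 1)) by exact: h hQ.
change (nbhs v (fun w : 'rV[R]_2 => A (annulus_shift x w))).
apply: filterS2 nP nQ => w Pw Qw.
exact: (PQA (circle_shift x.1 (w 0 0), x.2 + w 0 1)).
Qed.

Lemma has_differentialP f x (L : 'M[R]_2) : has_differential f x L <->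
  exists phi : 'rV[R]_2 -> 'rV[R]_2,
    [/\ phi 0 = 0,
        \forall v \near (0 : 'rV[R]_2), f (annulus_shift x v) = annulus_shift (f x) (phi v),
        differentiable phi (0 : 'rV[R]_2)
      & forall v, 'd phi (0 : 'rV[R]_2) v = v *m L].
Proof.
split=> -[phi [phi0 fphi dphi phiL]]; exists phi; split => //.
  by move=> v; rewrite -phiL mul_rV_lin1.
by apply/row_matrixP => i; rewrite !rowE mul_rV_lin1 phiL.
Qed.

Lemma near_norm_lt (phi : 'rV[R]_2 -> 'rV[R]_2) (e : R) (w : 'rV[R]_2) : 0 < e ->
  {for w, continuous phi} -> phi w = 0 -> \forall v \near w, `|phi v| < e.
Proof.
move=> e0 /cvgrPdist_lt /(_ e e0) + phi0; apply: filterS => v.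
by rewrite phi0 sub0r normrN.
Qed.

(** Two local expressions of [f] are continuous and vanish at 0, so near 0 they take values where
    the chart at [f x] is injective, and there they agree. This is what determines the [xget] in
    [Df]. *)
Lemma has_differential_unique f x (L M : 'M[R]_2) :
  has_differential f x L -> has_differential f x M -> L = M.
Proof.
move=> /has_differentialP[phi [phi0 fphi dphi phiL]].
move=> /has_differentialP[psi [psi0 fpsi dpsi psiM]].
have e0 : 0 < 1 / 2 :> R by lra.
have phipsi : \forall v \near (0 : 'rV[R]_2), phi v = psi v.
  have h1 := near_norm_lt e0 (differentiable_continuous dphi) phi0.
  have h2 := near_norm_lt e0 (differentiable_continuous dpsi) psi0.
  apply: filterS2 (filterI h1 h2) (filterI fphi fpsi) => v [v1 v2] [e1 e2].
  by apply: (@annulus_shift_inj (f x)) => //; rewrite -e1 -e2.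
apply/row_matrixP => i; rewrite !rowE -phiL -psiM.
have := near_eq_derive (delta_mx 0 i) phipsi.
by rewrite (deriveE _ dphi) (deriveE _ dpsi).
Qed.

Lemma DfE f x (L : 'M[R]_2) : has_differential f x L -> Df f x = L.
Proof.
move=> fL; have h : has_differential f x (Df f x).
  by apply: (@xgetPex _ 0 [set L | has_differential f x L]); exists L.
exact: has_differential_unique h fL.
Qed.

Lemma has_differential_id x : has_differential id x 1%:M.
Proof.
have idE : forall v, 'd id (0 : 'rV[R]_2) v = v by move=> v; rewrite diff_val.
apply/has_differentialP; exists id; split; [by []| |by []|];
  first exact: (@nearW _ (nbhs (0 : 'rV[R]_2)) _ (nbhs_filter _)).
by move=> v; rewrite idE mulmx1.
Qed.

Lemma has_differential_comp f g x (L M : 'M[R]_2) :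
  has_differential f x L -> has_differential g (f x) M ->
  has_differential (g \o f) x (L *m M).
Proof.
move=> /has_differentialP[phi [phi0 fphi dphi phiL]].
move=> /has_differentialP[psi [psi0 fpsi dpsi psiM]].
have dpsi' : differentiable psi (phi 0) by rewrite phi0.
apply/has_differentialP; exists (psi \o phi); split.
- by rewrite /= phi0.
- have fpsi' : \forall v \near (0 : 'rV[R]_2),
      g (annulus_shift (f x) (phi v)) = annulus_shift (g (f x)) (psi (phi v)).
    have c : phi v @[v --> (0 : 'rV[R]_2)] --> (0 : 'rV[R]_2).
      by rewrite -[X in _ --> X]phi0; exact: differentiable_continuous.
    exact: (c [set v | g (annulus_shift (f x) v) = annulus_shift (g (f x)) (psi v)] fpsi).
  apply: filterS2 fphi fpsi' => v e1 e2.
  by rewrite [LHS]/= e1 e2.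
- exact: differentiable_comp.
- move=> v; rewrite mulmxA -phiL -psiM -[X in 'd psi X]phi0.
  exact: (congr1 (@^~ v) (diff_comp dphi dpsi')).
Qed.

End shift.

(** * Iterates of a diffeomorphism, forward and backward, and the chain rule *)

Section iterates.
Context (R : realType).
Implicit Types (x y : annulus R) (v w : 'rV[R]_2) (f g h : annulus R -> annulus R).

Lemma mulmx2E n (A : 'M[R]_(n, 2)) p (B : 'M[R]_(2, p)) i j :
  (A *m B) i j = A i 0 * B 0 j + A i 1 * B 1 j.
Proof.
rewrite mxE !big_ord_recl big_ord0 addr0 (_ : lift _ _ = 1)//; exact/val_inj.
Qed.

Definition differentiable_map f := forall x, has_differential f x (Df f x).

Definition Df_continuous f := forall i j, continuous (fun x => Df f x i j).

Lemma C1_differentiable f : C1 f -> differentiable_map f.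
Proof. by move=> [fd _] x; have [L fL] := fd x; rewrite (DfE fL). Qed.

Lemma C1_Df_continuous f : C1 f -> Df_continuous f.
Proof.
move=> [_ cf] i j x.
exact: (continuous_comp (cf x) (@coord_continuous R 2 2 i j (Df f x))).
Qed.

Lemma differentiable_map_comp f g : differentiable_map f -> differentiable_map g ->
  differentiable_map (g \o f).
Proof.
by move=> df dg x; have h := has_differential_comp (df x) (dg (f x)); rewrite (DfE h).
Qed.

Lemma Df_comp f g x : differentiable_map f -> differentiable_map g ->
  Df (g \o f) x = Df f x *m Df g (f x).
Proof. by move=> df dg; exact/DfE/has_differential_comp. Qed.

Lemma Df_id x : Df id x = 1%:M :> 'M[R]_2.
Proof. exact/DfE/has_differential_id. Qed.

Lemma differentiable_map_iter f n : differentiable_map f -> differentiable_map (iter n f).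
Proof.
move=> df; elim: n => [|n IHn]; last exact: (differentiable_map_comp IHn df).
by move=> x; rewrite -[iter 0 f]/(id : annulus R -> annulus R) Df_id;
  exact: has_differential_id.
Qed.

Lemma continuous_iter f n : continuous f -> continuous (iter n f).
Proof.
move=> cf; elim: n => [|n IHn] x; first exact: cvg_id.
exact: (continuous_comp (IHn x) (cf _)).
Qed.

Lemma Df_continuous_iter f n : differentiable_map f -> continuous f -> Df_continuous f ->
  Df_continuous (iter n f).
Proof.
move=> df cf cdf; elim: n => [|n IHn] i j.
  rewrite (_ : (fun x => _) = cst ((1%:M : 'M[R]_2) i j)); first exact: cst_continuous.
  by apply/funext => x; rewrite -[iter 0 f]/(id : annulus R -> annulus R) Df_id.
rewrite (_ : (fun x => _) = (fun x => Df (iter n f) x i 0 * Df f (iter n f x) 0 j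
   + Df (iter n f) x i 1 * Df f (iter n f x) 1 j)).
  move=> x; have c k := continuous_comp (@continuous_iter f n cf x) (cdf k j (iter n f x)).
  apply: (@cvgD R R); apply: (@cvgM R _ _ _); by [exact: IHn|exact: c].
apply/funext => x; rewrite (Df_comp (f := iter n f) (g := f)) ?mulmx2E//.
exact: differentiable_map_iter.
Qed.

Lemma inverse_mapK f : bijective f -> cancel f (inverse_map f).
Proof. by move=> /bij_inj fi x; apply: pinvKV; rewrite ?in_setT// => ? ? _ _ /fi. Qed.

Lemma inverse_mapKV f : bijective f -> cancel (inverse_map f) f.
Proof.
move=> [g fg gf] x; apply: pinvK; rewrite in_setE; exists (g x) => //.
Qed.

Section diffeo.
Variable f : annulus R -> annulus R.
Hypothesis fbij : bijective f.

Lemma iterzS k x : iterz f (k + 1) x = f (iterz f k x).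
Proof.
case: k => [n|[|n]].
- by have -> : Posz n + 1 = Posz n.+1 by lia.
- by rewrite /= inverse_mapKV.
- have -> : Negz n.+1 + 1 = Negz n by lia.
  by rewrite /= inverse_mapKV.
Qed.

Lemma iterz_pred k x : iterz f (k - 1) x = inverse_map f (iterz f k x).
Proof. by rewrite -[in RHS](subrK 1 k) iterzS inverse_mapK. Qed.

Lemma iterzD j k x : iterz f (j + k) x = iterz f j (iterz f k x).
Proof.
elim/int_rect: j => [|n IHn|n IHn].
- by rewrite add0r.
- by rewrite -addn1 PoszD addrAC iterzS IHn iterzS.
- by rewrite -addn1 PoszD opprD addrAC iterz_pred IHn iterz_pred.
Qed.

Lemma iterzK k x : iterz f (- k) (iterz f k x) = x.
Proof. by rewrite -iterzD addNr. Qed.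

Lemma iterzKV k x : iterz f k (iterz f (- k) x) = x.
Proof. by rewrite -iterzD addrN. Qed.

Hypothesis fC1 : C1 f.
Hypothesis gC1 : C1 (inverse_map f).
Hypothesis fcont : continuous f.
Hypothesis gcont : continuous (inverse_map f).

Lemma continuous_iterz k : continuous (iterz f k).
Proof. by case: k => n; exact: continuous_iter. Qed.

Lemma differentiable_map_iterz k : differentiable_map (iterz f k).
Proof. by case: k => n; apply: differentiable_map_iter; exact: C1_differentiable. Qed.

Lemma Df_continuous_iterz k : Df_continuous (iterz f k).
Proof.
by case: k => n; apply: Df_continuous_iter => //;
  by [exact: C1_differentiable|exact: C1_Df_continuous].
Qed.

Lemma Df_iterzD j k x :
  Df (iterz f (j + k)) x = Df (iterz f k) x *m Df (iterz f j) (iterz f k x).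
Proof.
rewrite -Df_comp; try exact: differentiable_map_iterz.
by congr Df; apply/funext => y; exact: iterzD.
Qed.

Lemma Df_iterzN k x : Df (iterz f (- k)) (iterz f k x) *m Df (iterz f k) x = 1%:M.
Proof.
have := Df_iterzD k (- k) (iterz f k x); rewrite addrN iterzK => <-.
exact: Df_id.
Qed.

Lemma Gk_push k x : Gk f (k + 1) (f x) = Gk f k x *m Df f x.
Proof.
rewrite /Gk (_ : iterz f (- (k + 1)) (f x) = iterz f (- k) x).
  by rewrite addrC Df_iterzD iterzKV mulmxA.
by rewrite opprD iterzD -[f x]/(iterz f 1 x) iterzK.
Qed.

Lemma Gk_continuous k i : continuous (fun x => Gk f k x 0 i).
Proof.
rewrite (_ : (fun x => _) = (fun y => Df (iterz f k) y 1 i) \o iterz f (- k)).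
  move=> x; apply: continuous_comp; first exact: continuous_iterz.
  exact: Df_continuous_iterz.
by apply/funext => x /=; rewrite /Gk -rowE mxE.
Qed.

End diffeo.
End iterates.

(** * Exactness implies that Df has determinant 1 *)

Section jacobian_determinant.
Context (R : realType).
Implicit Types (x y : annulus R) (v w : 'rV[R]_2) (f g h : annulus R -> annulus R).

Definition pt (a b : R) : 'rV[R]_2 := \row_(i < 2) (if i == 0 then a else b).

Lemma pt_norm (a b m : R) : `|a| <= m -> `|b| <= m -> `|pt a b| <= m.
Proof.
move=> am bm; rewrite /Num.norm /= mx_normrE.
apply: bigmax_le => [|[i j] _ /=]; first exact: le_trans am.
by rewrite mxE; case: ifP.
Qed.

Lemma ptDZ0 (a b u t : R) : pt a b + (u - t) *: pt 1 0 = pt (a + (u - t)) b.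
Proof. by apply: row2P; rewrite !mxE /= ?mulr1 ?mulr0 ?addr0. Qed.

Lemma ptDZ1 (a b u t : R) : pt a b + (u - t) *: pt 0 1 = pt a (b + (u - t)).
Proof. by apply: row2P; rewrite !mxE /= ?mulr1 ?mulr0 ?addr0. Qed.

Lemma is_derive_line (F : 'rV[R]_2 -> R) (v : 'rV[R]_2) (t d : R) :
  is_derive (0 : 'rV[R]_2) v F d -> is_derive t 1 (fun u => F ((u - t) *: v)) d.
Proof.
move=> [dF Fd].
have E : (fun h : R => h^-1 *: (F ((h *: (1 : R) + t - t) *: v) - F ((t - t) *: v)))
       = (fun h : R => h^-1 *: (F (h *: v + 0) - F 0)).
  by apply/funext => h; rewrite addrK subrr scale0r addr0 /GRing.scale /= mulr1.
by split; [rewrite /derivable E|rewrite /derive E].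
Qed.

Lemma is_derive_coord (F : 'rV[R]_2 -> 'rV[R]_2) (v d : 'rV[R]_2) i :
  is_derive (0 : 'rV[R]_2) v F d -> is_derive (0 : 'rV[R]_2) v (fun w => F w 0 i) (d 0 i).
Proof.
move=> [dF <-]; split; first by have /derivable_mxP := dF; apply.
by rewrite derive_mx// mxE.
Qed.

Lemma MVT_segment0 (g D : R -> R) (h : R) : 0 < h ->
  (forall t, 0 <= t <= h -> is_derive t 1 g (D t)) ->
  exists2 xi, 0 <= xi <= h & g h - g 0 = D xi * h.
Proof.
move=> h0 gD.
have cg : {within `[0, h], continuous g}.
  by apply: derivable_within_continuous => t; rewrite in_itv /= => /gD [].
have gD' t : t \in `]0, h[ -> is_derive t 1 g (D t).
  by rewrite in_itv /= => /andP[/ltW t0 /ltW th]; apply: gD; rewrite t0.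
have [xi] := MVT h0 gD' cg.
by rewrite in_itv subr0 /= => /andP[/ltW x0 /ltW xh] E; exists xi => //; rewrite x0.
Qed.

(** [has_differential] speaks only of the centre of a chart. At another point of the chart, [f] has
    its own local expression [psi], and [phi (w + u) = phi w + psi u] for small [u] by injectivity
    of the chart at [f x]. A single expression [phi] is thus differentiable near 0, with derivative
    read from [Df]. *)
Lemma chart_derivative f x : differentiable_map f -> exists phi : 'rV[R]_2 -> 'rV[R]_2,
  [/\ phi 0 = 0,
      \forall w \near (0 : 'rV[R]_2), f (annulus_shift x w) = annulus_shift (f x) (phi w) /\
        forall v, is_derive (0 : 'rV[R]_2) v (fun u => phi (w + u)) (v *m Df f
          (annulus_shift x w))
    & forall e, 0 < e -> \forall w \near (0 : 'rV[R]_2), `|phi w - w *m Df f x| <= e *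
      `|w|].
Proof.
move=> df; have /has_differentialP[phi [phi0 fphi dphi phiL]] := df x.
exists phi; split => //.
  (* With both terms below 1/4, [phi w + psi u] stays below 1/2, where the chart is injective. *)
  have e0 : 0 < 1 / 4 :> R by lra.
  have [d /= d0 dB] := (nbhs_ballP _ _).1 (@filterI _ (nbhs (0 : 'rV[R]_2)) (nbhs_filter _)
    _ _
    (near_norm_lt e0 (differentiable_continuous dphi) phi0) fphi).
  have n := nbhsx_ballx (0 : 'rV[R]_2) d d0.
  apply: (@filterS _ (nbhs (0 : 'rV[R]_2)) (nbhs_filter _) _ _ _ n) => w wd.
  have [phiw fw] := dB w wd; split=> // v.
  have /has_differentialP[psi [psi0 fpsi dpsi psiM]] := df (annulus_shift x w).
  have near_phi : \forall u \near (0 : 'rV[R]_2), phi w + psi u = phi (w + u).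
    have wball : \forall u \near (0 : 'rV[R]_2), ball 0 d (w + u).
      have wd' : `|w| < d by move: wd; rewrite -ball_normE /= sub0r normrN.
      have ud : 0 < d - `|w| by rewrite subr_gt0.
      have near_u := near_norm_lt ud (@cvg_id _ _) (erefl (0 : 'rV[R]_2)).
      apply: (@filterS _ (nbhs (0 : 'rV[R]_2)) (nbhs_filter _) _ _ _ near_u) => u uw.
      rewrite -ball_normE /= sub0r normrN (le_lt_trans (ler_normD _ _))//.
      by rewrite -ltrBrDl.
    apply: (@filterS2 _ (nbhs (0 : 'rV[R]_2)) (nbhs_filter _) _ _ _ _ (@filterI _ (nbhs (0
      : 'rV[R]_2)) (nbhs_filter _) _ _ (near_norm_lt e0 (differentiable_continuous dpsi)
      psi0) fpsi) wball).
    move=> u [psiu]; rewrite fw !annulus_shiftD => eu wu.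
    have [phiwu fwu] := dB _ wu.
    apply: (@annulus_shift_inj _ (f x)).
    - have := ler_normD (phi w) (psi u); move: phiw psiu => /=; lra.
    - by move: phiwu => /=; lra.
    - by rewrite -eu fwu.
  apply: near_eq_is_derive near_phi _.
  rewrite -psiM -deriveE//.
  have -> : 'D_v psi 0 = 0 + 'D_v psi 0 by rewrite add0r.
  apply: (is_deriveD (f := cst (phi w)) (g := psi)).
  exact/derivableP/diff_derivable.
move=> e e0.
have [_] := (diff_locallyP 0 phi).1 dphi.
move=> /eqaddoP /(_ e e0); apply: filterS => w.
rewrite /= phi0 => h; apply: le_trans h.
have -> : (phi \o +%R^~ 0 - (cst 0 + 'd phi 0)) w = phi (w + 0) - (0 + 'd phi 0 w) by [].
by rewrite addr0 add0r phiL.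
Qed.

Lemma is_derive_shift_coord w v i :
  is_derive (0 : 'rV[R]_2) v (fun u : 'rV[R]_2 => (w + u) 0 i) (v 0 i).
Proof.
have h := is_deriveD (is_derive_cst w (0 : 'rV[R]_2) v) (is_derive_id (0 : 'rV[R]_2) v).
by rewrite add0r in h; exact: (is_derive_coord i h).
Qed.

(* G is a primitive of phi_1 dphi_0 - w_1 dw_0, f being read as phi in the charts.
   The second difference of G over the square [0, h]^2, computed by the mean value
   theorem along either pair of opposite sides, is (a d - 1) h^2 + o(h^2) and
   b c h^2 + o(h^2). *)
Lemma conservative_det f x : differentiable_map f -> Df_continuous f ->
  exact_form (pullback_liouville_diff f) ->
  Df f x 0 0 * Df f x 1 1 - Df f x 0 1 * Df f x 1 0 = 1.
Proof.
move=> df cdf [S Sd].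
have [phi [phi0 phid phiL]] := chart_derivative x df.
set a := Df f x 0 0; set c := Df f x 0 1; set b := Df f x 1 0; set d := Df f x 1 1.
pose L w := Df f (annulus_shift x w).
(* The heights in the Liouville form are measured from 0, those of the chart from [(f x).2] and
   [x.2]; the two correction terms move the origin to the centres of the charts. *)
pose G w := S (annulus_shift x w) - (f x).2 * phi w 0 0 + x.2 * w 0 0.
have GD w v : f (annulus_shift x w) = annulus_shift (f x) (phi w) ->
    (forall v, is_derive (0 : 'rV[R]_2) v (fun u => phi (w + u)) (v *m L w)) ->
    is_derive (0 : 'rV[R]_2) v (fun u => G (w + u))
      (phi w 0 1 * (v *m L w) 0 0 - w 0 1 * v 0 0).
  move=> fw phiw.
  have [Sdw Sv] := Sd (annulus_shift x w).
  have D1 : is_derive (0 : 'rV[R]_2) v (fun u => S (annulus_shift x (w + u)))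
      (pullback_liouville_diff f (annulus_shift x w) v).
    rewrite (_ : (fun u => _) = (fun u => S (annulus_shift (annulus_shift x w) u)));
      last first.
      by apply/funext => u; rewrite annulus_shiftD.
    by rewrite -Sv -deriveE//; exact/derivableP/diff_derivable.
  have D2 := is_deriveZ (f x).2 (is_derive_coord 0 (phiw v)).
  have D3 := is_deriveZ x.2 (is_derive_shift_coord w v 0).
  apply: (is_derive_eq (is_deriveD (is_deriveB D1 D2) D3)).
  rewrite /pullback_liouville_diff fw /= -/(L w) /GRing.scale /=; ring.
(* Each of the four corner products has an error of at most [e * h] times [1 + |c| + |d|] plus [|a|]
   or [|b|]; the factor 4 covers their sum after multiplication by [h], and [e < 1] bounds the
   perturbed entries. *)
have main e : 0 < e -> e < 1 -> `|a * d - 1 - b * c| <=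
    e * (4 * (`|a| + `|b| + `|c| + `|d| + 1)).
  move=> e0 e1.
  have cL i j : \forall w \near (0 : 'rV[R]_2), `|L w i j - Df f x i j| < e.
    have cL0 : L w i j @[w --> (0 : 'rV[R]_2)] --> Df f x i j.
      rewrite -[X in Df f X](annulus_shift0 x).
      exact: (continuous_comp (@continuous_annulus_shift R x 0) (cdf i j _)).
    have /cvgrPdist_lt /(_ e e0) := cL0.
    by apply: (@filterS _ (nbhs (0 : 'rV[R]_2)) (nbhs_filter _)) => w; rewrite distrC.
  pose F := nbhs (0 : 'rV[R]_2); have FF : Filter F := nbhs_filter _.
  have [r r0 rP] := (nbhs_ballP _ _).1 (@filterI _ F FF _ _ (@filterI _ F FF _ _ phid (phiL
    e e0))
    (@filterI _ F FF _ _ (cL 0 0) (cL 1 0))).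
  pose h := r / 2; have h0 : 0 < h by rewrite divr_gt0.
  have good u t : 0 <= u <= h -> 0 <= t <= h -> [/\
      forall v, is_derive (0 : 'rV[R]_2) v (fun s => G (pt u t + s))
        (phi (pt u t) 0 1 * (v *m L (pt u t)) 0 0 - t * v 0 0),
      `|phi (pt u t) 0 1 - (u * c + t * d)| <= e * h,
      `|L (pt u t) 0 0 - a| <= e & `|L (pt u t) 1 0 - b| <= e].
    move=> /andP[u0 uh] /andP[t0 th].
    have pth : `|pt u t| <= h by apply: pt_norm; rewrite ger0_norm.
    have [] := rP (pt u t).
      by rewrite -ball_normE /= sub0r normrN (le_lt_trans pth)// ltr_pdivrMr// ltr_pMr//
        ltr1n.
    move=> [[fw phiw] phie] [La Lb]; split; [|..] => [v|||]; try exact: ltW.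
      by have := GD _ v fw phiw; rewrite [pt u t 0 1]mxE.
    have := mx_norm_ge_entry (phi (pt u t) - pt u t *m Df f x) 1.
    have -> : (phi (pt u t) - pt u t *m Df f x) 0 1 = phi (pt u t) 0 1 - (pt u t *m Df f x)
      0 1.
      by rewrite !mxE.
    rewrite mulmx2E [pt u t 0 0]mxE [pt u t 0 1]mxE /=.
    by move=> /le_trans; apply; rewrite (le_trans phie)// ler_pM2l.
  have colG t k : 0 <= t <= h -> 0 <= k <= h ->
      is_derive t 1 (fun u => G (pt u k)) (phi (pt t k) 0 1 * L (pt t k) 0 0 - k).
    move=> th kh; have [D _ _ _] := good t k th kh.
    have := is_derive_line t (D (pt 1 0)).
    rewrite mulmx2E [pt 1 0 0 0]mxE [pt 1 0 0 1]mxE /= mul1r mul0r addr0 mulr1.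
    by congr is_derive; apply/funext => u; rewrite ptDZ0 addrC subrK.
  have rowG t k : 0 <= t <= h -> 0 <= k <= h ->
      is_derive t 1 (fun u => G (pt k u)) (phi (pt k t) 0 1 * L (pt k t) 1 0).
    move=> th kh; have [D _ _ _] := good k t kh th.
    have := is_derive_line t (D (pt 0 1)).
    rewrite mulmx2E [pt 0 1 0 0]mxE [pt 0 1 0 1]mxE /= mul1r mul0r add0r mulr0 subr0.
    by congr is_derive; apply/funext => u; rewrite ptDZ1 addrC subrK.
  have h00 : 0 <= (0 : R) <= h by rewrite lexx ltW.
  have hhh : 0 <= h <= h by rewrite lexx ltW.
  have [xi xih E1] := MVT_segment0 h0 (fun t th => is_deriveB (colG t h th hhh) (colG t 0
    th h00)).
  have [eta etah E2] := MVT_segment0 h0 (fun t th => is_deriveB (rowG t h th hhh) (rowG t 0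
    th h00)).
  have {}E1 : (G (pt h h) - G (pt h 0)) - (G (pt 0 h) - G (pt 0 0)) = _ := E1.
  have {}E2 : (G (pt h h) - G (pt 0 h)) - (G (pt h 0) - G (pt 0 0)) = _ := E2.
  have [_ p1 A1 _] := good xi h xih hhh; have [_ p2 A2 _] := good xi 0 xih h00.
  have [_ p3 _ A3] := good h eta hhh etah; have [_ p4 _ A4] := good 0 eta h00 etah.
  have est p A u t k : 0 <= u <= h -> 0 <= t <= h -> `|p - (u * c + t * d)| <= e * h ->
      `|A - k| <= e -> `|p * A - (u * c + t * d) * k| <= e * h * (`|k| + 1 + `|c| + `|d|).
    move=> /andP[u0 uh] /andP[t0 th] pe Ae.
    have -> : p * A - (u * c + t * d) * k = (p - (u * c + t * d)) * A + (u * c + t * d) *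
      (A - k) by ring.
    have Ak : `|A| <= `|k| + 1.
      by rewrite -[A](subrK k) addrC (le_trans (ler_normD _ _))// lerD2l (le_trans Ae)//
        ltW.
    have ucd : `|u * c + t * d| <= h * (`|c| + `|d|).
      rewrite (le_trans (ler_normD _ _))// !normrM mulrDr lerD// ler_wpM2r// ger0_norm//.
    rewrite (le_trans (ler_normD _ _))// !normrM.
    have : `|p - (u * c + t * d)| * `|A| <= (e * h) * (`|k| + 1) by exact: ler_pM.
    have : `|u * c + t * d| * `|A - k| <= (h * (`|c| + `|d|)) * e by exact: ler_pM.
    by lra.
  have {p1 A1} e1' := est _ _ _ _ _ xih hhh p1 A1; have {p2 A2} e2 := est _ _ _ _ _ xih h00
    p2 A2.
  have {p3 A3} e3 := est _ _ _ _ _ hhh etah p3 A3; have {p4 A4} e4 := est _ _ _ _ _ h00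
    etah p4 A4.
  rewrite -(ler_pM2r h0) -{1}(gtr0_norm h0) -normrM.
  have D12 : (phi (pt xi h) 0 1 * L (pt xi h) 0 0 - h) - (phi (pt xi 0) 0 1 * L (pt xi 0) 0
    0 - 0)
    = phi (pt h eta) 0 1 * L (pt h eta) 1 0 - phi (pt 0 eta) 0 1 * L (pt 0 eta) 1 0.
    by apply: (mulIf (lt0r_neq0 h0)); rewrite -E1 -E2; ring.
  move: D12 e1' e2 e3 e4; set P1 := phi _ 0 1 * _; set P2 := phi _ 0 1 * _.
  set P3 := phi _ 0 1 * _; set P4 := phi _ 0 1 * _.
  move=> D12 e1' e2 e3 e4.
  have -> : (a * d - 1 - b * c) * h = (P3 - (h * c + eta * d) * b) - (P4 - (0 * c + eta *
    d) * b)
    - ((P1 - (xi * c + h * d) * a) - (P2 - (xi * c + 0 * d) * a)).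
    have -> : P1 = P3 - P4 + P2 + h by lra.
    ring.
  have n0 := (normr_ge0 a, normr_ge0 b, normr_ge0 c, normr_ge0 d).
  apply: le_trans (ler_normB _ _) _.
  apply: le_trans (lerD (ler_normB _ _) (ler_normB _ _)) _.
  apply: le_trans (lerD (lerD e3 e4) (lerD e1' e2)) _.
  rewrite -subr_ge0.
  have -> : e * (4 * (`|a| + `|b| + `|c| + `|d| + 1)) * h - (e * h * (`|b| + 1 + `|c| +
    `|d|) + e * h * (`|b| + 1 + `|c| + `|d|)
    + (e * h * (`|a| + 1 + `|c| + `|d|) + e * h * (`|a| + 1 + `|c| + `|d|))) = e * h * (2 *
      (`|a| + `|b|)) by ring.
  by rewrite !mulr_ge0// ?addr_ge0// ltW.
suff : a * d - 1 - b * c = 0 by lra.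
apply/eqP; rewrite -normr_le0; apply/ler_addgt0Pr => z z0; rewrite add0r.
pose K := 4 * (`|a| + `|b| + `|c| + `|d| + 1).
have K0 : 0 < K by rewrite mulr_gt0// ltr_wpDl// !addr_ge0.
pose e := Num.min (1 / 2) (z / K).
have e0 : 0 < e by rewrite lt_min !divr_gt0.
have e1 : e < 1 by rewrite gt_min; apply/orP; left; lra.
apply: le_trans (main e e0 e1) _.
by rewrite -ler_pdivlMr// ge_min lexx orbT.
Qed.

End jacobian_determinant.

(** * Borel probability measures on the annulus *)

Section annulus_measure.
Local Open Scope quotient_scope.
Context (R : realType).
Notation A := (annulus R).
Notation bA := (borel_annulus R).

Lemma open_measurable_annulus (U : set A) : open U -> measurable (U : set bA).
Proof. by move=> oU; exact: sub_sigma_algebra. Qed.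

Lemma continuous_measurable_annulus (f : A -> A) : continuous f ->
  measurable_fun setT (f : bA -> bA).
Proof.
move=> /continuousP cf.
apply: (@measurability _ _ bA bA setT f (@open A) (erefl _)) => _ [U oU <-].
by rewrite setTI; apply: open_measurable_annulus; exact: cf.
Qed.

(** At a point of [K] continuity makes the preimage of an open interval a neighbourhood, so within
    [K] this preimage coincides with its interior, an open set. *)
Lemma continuous_measurable_fun_on (K : set A) (h : A -> R) :
  measurable (K : set bA) -> (forall x, K x -> {for x, continuous h}) ->
  measurable_fun (K : set bA) h.
Proof.
move=> mK ch; apply: (measurability _ (RGenOpens.measurableE R)) => _ [_ [a [b ->]] <-].
rewrite (_ : K `&` _ = K `&` interior (h @^-1` `]a, b[%classic)).
  by apply: measurableI => //; apply: open_measurable_annulus; exact: open_interior.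
apply/seteqP; split=> x [Kx hx]; split => //.
  by apply: ch => //; apply: open_nbhs_nbhs; split => //; exact: interval_open.
exact: interior_subset hx.
Qed.

Lemma compact_bounded_on (K : set A) (h : A -> R) : compact K ->
  (forall x, K x -> {for x, continuous h}) -> exists C, forall x, K x -> `|h x| <= C.
Proof.
move=> cK ch.
have ch' : {within K, continuous h}.
  by apply: continuous_in_subspaceT => x; rewrite inE => /ch.
have [M [Mr MP]] := compact_bounded (continuous_compact ch' cK).
exists (M + 1) => x Kx; apply: (MP (M + 1)); first by rewrite ltrDl.
by exists x.
Qed.

(** * The support of a Borel probability measure *)

Section support.
Variable mu : probability bA R.

Lemma measure_supp_closed : open (~` measure_supp mu).
Proof.
rewrite openE => x /existsNP[U /not_implyP[oU /not_implyP[Ux U0]]].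
apply: (@filterS _ _ _ U); last exact: open_nbhs_nbhs.
by move=> y Uy /(_ U oU Uy).
Qed.

Lemma measurable_measure_supp : measurable (measure_supp mu : set bA).
Proof.
rewrite -[X in measurable X]setCK; apply: measurableC.
by apply: open_measurable_annulus; exact: measure_supp_closed.
Qed.

Definition rational_ball (k : rat * rat * nat) : set 'rV[R]_2 :=
  ball (pt (ratr k.1.1) (ratr k.1.2) : 'rV[R]_2) k.2.+1%:R^-1.

Lemma rational_ball_nbhs (w : 'rV[R]_2) (U : set 'rV[R]_2) : nbhs w U ->
  exists2 k, rational_ball k w & rational_ball k `<=` U.
Proof.
move=> /nbhs_ballP[e /= e0 eU].
have [n _ /(_ n (leqnn _)) ne] := near_infty_natSinv_lt (PosNum (divr_gt0 e0 (ltr0n R 2))).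
have n0 : 0 < n.+1%:R^-1 :> R by rewrite invr_gt0.
have rat_near (c r : R) : 0 < r -> exists q : rat, `|ratr q - c| < r.
  move=> r0; have [|q] := @rat_in_itvoo R (c - r) (c + r); first lra.
  by rewrite in_itv /= => qP; exists q; rewrite ltr_norml; lra.
have h i := rat_near (w 0 i) _ n0.
have [p pP] := h 0; have [q qP] := h 1.
have wb : rational_ball (p, q, n) w.
  rewrite /rational_ball -ball_normE /=.
  rewrite /Num.norm /= mx_normrE; apply: bigmax_lt => // -[i j] _ /=.
  rewrite !mxE (ord1 i); case: ifPn => [/eqP -> //|].
  by case: (unliftP 0 j) => [j' -> _|->//]; rewrite (ord1 j') (_ : lift _ _ = 1)//;
    apply/val_inj.
exists (p, q, n) => // v vb; apply: eU.
have := ball_triangle (ball_sym wb) vb; apply: le_ball.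
by rewrite [leRHS]splitr lerD// ltW.
Qed.

(* Each point outside the support has a null open neighbourhood that contains the
   image of a rational ball of the universal cover, and countably many such
   neighbourhoods suffice. *)
Lemma measure_supp_full : mu.-negligible (~` measure_supp mu).
Proof.
(* The chart at [x0] is the universal covering map. [V k] is some null open set containing the image
   of the ball [k], and [set0] when there is none, so it is negligible in either case. *)
pose x0 : A := (to_circle 0, 0).
pose V k : set A := xget set0 [set U : set A | [/\ open U, mu (U : set bA) = 0%E
  & annulus_shift x0 @` rational_ball k `<=` U]].
have V0 k : mu.-negligible (V k : set bA).
  rewrite /V; case: xgetP => [U _ [oU U0 _]|_]; last exact: negligible_set0.
  exists U; split; [exact: (open_measurable_annulus oU)|exact: U0|exact: subset_refl].
pose F n : set bA := if unpickle n is Some k then V k else set0.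
have F0 n : mu.-negligible (F n).
  by rewrite /F; case: unpickle => [k|]; [exact: V0|exact: negligible_set0].
apply: negligibleS (negligible_bigcup F0).
move=> x /existsNP[U /not_implyP[oU /not_implyP[Ux U0]]].
have U00 : mu (U : set bA) = 0%E.
  by apply/eqP; rewrite eq_le measure_ge0 andbT leNgt; exact/negP.
pose w := pt (repr (x.1 : {eq_quot @eqmodZ R})) x.2.
have xw : annulus_shift x0 w = x.
  case: x @w {Ux} => t r w; rewrite /annulus_shift /= circle_shift_to_circle.
  by rewrite !mxE /= !add0r to_circle_repr.
have [k kw kU] : exists2 k, rational_ball k w & rational_ball k `<=` annulus_shift x0 @^-1`
  U.
  apply: rational_ball_nbhs; apply: continuous_annulus_shift.
  by apply: open_nbhs_nbhs; split => //; rewrite xw.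
exists (pickle k); [exact: I|rewrite /F pickleK /V].
case: xgetP => [W _ [_ _ kW]|/(_ U)].
  by apply: kW; exists w.
by case; split; [exact: oU|exact: U00|move=> _ [v kv <-]; exact: kU].
Qed.

Lemma measure_supp_invariant (f g : A -> A) : continuous f -> continuous g ->
  cancel f g -> cancel g f -> invariant_measure f mu ->
  forall x, measure_supp mu (f x) <-> measure_supp mu x.
Proof.
move=> cf cg fg gf finv x; split => h U oU Ux.
  have := h (g @^-1` U); rewrite -finv; last first.
    by apply: open_measurable_annulus; move/continuousP : cg; apply.
  rewrite (_ : f @^-1` (g @^-1` U) = U); last first.
    by apply/seteqP; split => y /=; rewrite fg.
  by apply; [move/continuousP : cg; apply|rewrite /= fg].
rewrite -finv; last exact: open_measurable_annulus.
by apply: h => //; move/continuousP : cf; apply.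
Qed.
End support.
End annulus_measure.

(** * Products of triangular matrices *)

Section subexponential.
Context (R : realType).
Implicit Types (u w P B b q t : nat -> R).

(** The one-sided condition limsup of ln (u n) / n at most 0, written without logarithms so that it
    also makes sense when [u] vanishes and passes to sums and products. *)
Definition subexp u := forall e : R, 0 < e ->
  exists2 K, 0 < K & forall n, u n <= K * expR (e * n%:R).

Lemma eventually_le_all u w N : (forall n, 0 < w n) ->
  (forall n, (N <= n)%N -> u n <= w n) -> exists2 K, 0 < K & forall n, u n <= K * w n.
Proof.
move=> w0 uw; exists (1 + \sum_(i < N) `|u i| / w i).
  by rewrite ltr_pwDl// sumr_ge0// => i _; rewrite divr_ge0// ltW.
move=> n; rewrite mulrDl mul1r; have [Nn|nN] := leqP N n.
  apply: le_trans (uw _ Nn) _; rewrite lerDl mulr_ge0// ?(ltW (w0 n))//.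
  by rewrite sumr_ge0// => i _; rewrite divr_ge0// ltW.
rewrite -[u n]add0r lerD ?(ltW (w0 n))// -ler_pdivrMr//.
rewrite (bigD1 (Ordinal nN)) //= -[leLHS]addr0 lerD//.
  by rewrite ler_pM2r ?invr_gt0// ler_norm.
by rewrite sumr_ge0// => i _; rewrite divr_ge0// ltW.
Qed.

Lemma subexp_le u w : (forall n, u n <= w n) -> subexp w -> subexp u.
Proof.
move=> uw we e e0; have [K K0 wK] := we e e0.
by exists K => // n; exact: le_trans (uw n) (wK n).
Qed.

Lemma subexpD u w : subexp u -> subexp w -> subexp (fun n => u n + w n).
Proof.
move=> us ws e e0; have [K K0 uK] := us e e0; have [L L0 wL] := ws e e0.
by exists (K + L) => [|n]; [exact: addr_gt0|rewrite mulrDl lerD].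
Qed.

Lemma subexpM u w : (forall n, 0 <= u n) -> (forall n, 0 <= w n) ->
  subexp u -> subexp w -> subexp (fun n => u n * w n).
Proof.
move=> u0 w0 us ws e e0; have e20 : 0 < e / 2 by rewrite divr_gt0.
have [K K0 uK] := us _ e20; have [L L0 wL] := ws _ e20.
exists (K * L) => [|n]; first exact: mulr_gt0.
have -> : e * n%:R = e / 2 * n%:R + e / 2 * n%:R by rewrite -mulrDl -splitr.
by rewrite expRD mulrACA ler_pM.
Qed.

Lemma subexp_cst (c : R) : subexp (fun=> c).
Proof.
move=> e e0; exists (`|c| + 1) => [|n]; first by rewrite ltr_wpDl.
rewrite -[leLHS]mulr1 (le_trans (y := (`|c| + 1) * 1))//.
  by rewrite ler_pM2r// (le_trans (ler_norm c))// lerDl.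
by rewrite ler_pM2l ?ltr_wpDl// -expR0 ler_expR mulr_ge0// ltW.
Qed.

Lemma subexpZ (c : R) u : 0 <= c -> (forall n, 0 <= u n) -> subexp u ->
  subexp (fun n => c * u n).
Proof. by move=> c0 u0; apply: subexpM => //; exact: subexp_cst. Qed.

Lemma subexpS u : subexp u -> subexp (fun n => u n.+1).
Proof.
move=> us e e0; have [K K0 uK] := us e e0; exists (K * expR e) => [|n].
  by rewrite mulr_gt0// expR_gt0.
by rewrite (le_trans (uK _))// -mulrA -expRD mulrS mulrDr mulr1.
Qed.

(** Half of [e] bounds each term; the other half absorbs the number [n] of terms, through 1 + x <=
    exp x. *)
Lemma subexp_sum u : subexp u -> subexp (fun n => \sum_(i < n) u i).
Proof.
move=> us e e0; have e20 : 0 < e / 2 by rewrite divr_gt0.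
have [K K0 uK] := us _ e20; exists (K / (e / 2)) => [|n]; first exact: divr_gt0.
have -> : e * n%:R = e / 2 * n%:R + e / 2 * n%:R by rewrite -mulrDl -splitr.
apply: (@le_trans _ _ (\sum_(i < n) K * expR (e / 2 * n%:R))).
  apply: ler_sum => i _; rewrite (le_trans (uK i))// ler_pM2l// ler_expR.
  by rewrite ler_pM2l// ler_nat ltnW.
rewrite sumr_const card_ord -[leLHS]mulr_natr expRD.
set E := expR _; have E0 : 0 < E by exact: expR_gt0.
have nE : n%:R <= (e / 2)^-1 * E.
  rewrite ler_pdivlMl//; have h := expR_ge1Dx (e / 2 * n%:R); rewrite -/E in h.
  by rewrite (le_trans _ h)// lerDr.
have -> : K / (e / 2) * (E * E) = K * E * ((e / 2)^-1 * E) by rewrite mulrACA mulrA.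
by rewrite ler_pM2l// mulr_gt0.
Qed.

Lemma rate_bounds P (L e : R) : (forall n, 0 < P n) -> 0 < e ->
  n%:R^-1 * ln (P n) @[n --> \oo] --> L ->
  (exists2 K, 0 < K & forall n, P n <= K * expR ((L + e) * n%:R)) /\
  (exists2 K, 0 < K & forall n, (P n)^-1 <= K * expR ((e - L) * n%:R)).
Proof.
move=> P0 e0 /cvgrPdist_le /(_ e e0) [N _ NP].
have h n : (N.+1 <= n)%N -> `|ln (P n) - L * n%:R| <= e * n%:R.
  move=> Nn; have n0 : 0 < n%:R :> R by rewrite ltr0n (leq_trans _ Nn).
  have := NP n (ltnW Nn); rewrite distrC => /= h.
  have -> : ln (P n) - L * n%:R = (n%:R^-1 * ln (P n) - L) * n%:R.
    by rewrite mulrBl mulrAC mulVf ?gt_eqF// mul1r.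
  by rewrite normrM (gtr0_norm n0) ler_pM2r.
split; apply: (@eventually_le_all _ _ N.+1) => [n|n /h]; rewrite ?expR_gt0//.
  rewrite ler_norml => /andP[_ hn].
  by rewrite -[leLHS]lnK ?posrE// ler_expR; lra.
rewrite ler_norml => /andP[hn _].
rewrite -[leLHS]lnK ?posrE ?invr_gt0// ler_expR lnV ?posrE//; lra.
Qed.

Lemma rate0_subexp P : (forall n, 0 < P n) ->
  n%:R^-1 * ln (P n) @[n --> \oo] --> (0 : R) ->
  subexp P /\ subexp (fun n => (P n)^-1).
Proof.
move=> P0 P1; split => e e0; have [] := rate_bounds P0 e0 P1.
  by rewrite add0r.
by rewrite subr0.
Qed.

Lemma subexp_rate0 u : (forall n, 0 < u n) -> subexp u -> subexp (fun n => (u n)^-1) ->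
  n%:R^-1 * ln (u n) @[n --> \oo] --> (0 : R).
Proof.
move=> u0 us us'; apply/cvgrPdist_le => e e0; have e20 : 0 < e / 2 by rewrite divr_gt0.
have [K K0 uK] := us _ e20; have [L L0 uL] := us' _ e20.
have c0 : 0 <= (`|ln K| + `|ln L|) / (e / 2) by rewrite divr_ge0// ltW.
exists (Num.bound ((`|ln K| + `|ln L|) / (e / 2))).+1 => // n /= bn.
have n0 : 0 < n%:R :> R by rewrite ltr0n (leq_trans _ bn).
have : (`|ln K| + `|ln L|) / (e / 2) < n%:R.
  by rewrite (lt_le_trans (archi_boundP c0))// ler_nat ltnW.
rewrite ltr_pdivrMr// => cn.
rewrite sub0r normrN normrM gtr0_norm ?invr_gt0// ler_pdivrMl//.
have ub (c x : R) : 0 < c -> 0 < x -> x <= c * expR (e / 2 * n%:R) -> ln x <= ln c + e / 2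
  * n%:R.
  move=> c0' x0 xc; rewrite -[_ * n%:R]expRK -lnM ?posrE ?expR_gt0// ler_ln ?posrE//.
  by rewrite mulr_gt0// expR_gt0.
have := ub _ _ K0 (u0 n) (uK n).
have := ub _ _ L0 _ (uL n); rewrite invr_gt0 lnV ?posrE// => /(_ (u0 n)).
have := ler_norm (ln K); have := ler_norm (ln L).
have := normr_ge0 (ln K); have := normr_ge0 (ln L).
move: cn; set N := n%:R; have -> : N * e = e / 2 * N + e / 2 * N by field.
have -> : N * (e / 2) = e / 2 * N by rewrite mulrC.
by rewrite ler_norml => *; apply/andP; split; lra.
Qed.

Section triangular.
(* The matrix of Df^n in the frames (line s, vert) is [[P n, 0], [B n, 1 / P n]]. *)
Variables (P B b q : nat -> R).
Hypothesis P0 : P 0%N = 1.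
Hypothesis PS : forall n, P n.+1 = P n * q n.
Hypothesis q_gt0 : forall n, 0 < q n.
Hypothesis B0 : B 0%N = 0.
Hypothesis BS : forall n, B n.+1 = B n * q n + b n / P n.
Variable M : R.
Hypothesis bM : forall n, `|b n| <= M.

Lemma P_gt0 n : 0 < P n.
Proof. by elim: n => [|n IHn]; [rewrite P0|rewrite PS mulr_gt0]. Qed.

Lemma off_diagonalE n : B n = P n * \sum_(i < n) b i / (P i * P i.+1).
Proof.
elim: n => [|n IHn]; first by rewrite B0 big_ord0 mulr0.
have := P_gt0 n; have := q_gt0 n => qn Pn.
rewrite BS IHn big_ord_recr /= PS mulrDr mulrAC; congr (_ + _).
by field; rewrite !gt_eqF.
Qed.

Lemma off_diagonal_bound n : `|B n| <= P n * \sum_(i < n) M * ((P i)^-1 * (P i.+1)^-1).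
Proof.
rewrite off_diagonalE normrM (gtr0_norm (P_gt0 n)) ler_pM2l ?P_gt0//.
rewrite (le_trans (ler_norm_sum _ _ _))//; apply: ler_sum => i _.
rewrite normrM normfV -invfM (gtr0_norm (mulr_gt0 (P_gt0 _) (P_gt0 _))).
by rewrite ler_pM2r// invr_gt0 mulr_gt0// P_gt0.
Qed.

(** With [L > 0] the series of b_i / (P_i P_(i+1)) is dominated by a geometric one, so [|B n|] is at
    most a constant times [P n], and [t n], the ratio of [P n] to [B n], cannot tend to 0. *)
Lemma triangular_rate_le0 (L : R) t : n%:R^-1 * ln (P n) @[n --> \oo] --> L ->
  t n @[n --> \oo] --> (0 : R) -> (forall n, (0 < n)%N -> t n * B n = P n) -> L <= 0.
Proof.
move=> PL t0 tBP; rewrite leNgt; apply/negP => L0.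
have M0 : 0 <= M by exact: le_trans (bM 0%N).
(* Half of the supposed rate is given up as margin; the other half gives the ratio [r] of the
   geometric series. *)
have e0 : 0 < L / 2 by rewrite divr_gt0.
have [_ [K K0 PK]] := rate_bounds P_gt0 e0 PL.
have r01 : expR (- (L / 2)) < 1 by rewrite -[ltRHS]expR0 ltr_expR oppr_lt0.
set r := expR (- (L / 2)) in r01; have r0 : 0 < r by exact: expR_gt0.
have Pr n : (P n)^-1 <= K * r ^+ n.
  apply: le_trans (PK n) _; rewrite ler_pM2l// /r -expRM_natl.
  by rewrite ler_expR -mulr_natl; lra.
pose C := M * K ^+ 2 / (1 - r).
have C0 : 0 <= C by rewrite !mulr_ge0// ?invr_ge0 ?subr_ge0// ltW.
have BC n : `|B n| <= P n * C.
  apply: le_trans (off_diagonal_bound n) _; rewrite ler_pM2l ?P_gt0//.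
  apply: (@le_trans _ _ (\sum_(i < n) M * K ^+ 2 * r ^+ i)).
    apply: ler_sum => i _; rewrite -mulrA ler_wpM2l//.
    apply: (@le_trans _ _ ((K * r ^+ i) * (K * r ^+ i.+1))).
      by rewrite ler_pM// invr_ge0 ltW// P_gt0.
    rewrite mulrACA -expr2 ler_wpM2l ?exprn_ge0 ?(ltW K0)//.
    by rewrite ler_piMr ?exprn_ge0 ?(ltW r0)// exprn_ile1// ltW.
  rewrite -mulr_sumr /C ler_wpM2l ?mulr_ge0 ?exprn_ge0 ?(ltW K0)//.
  have r1 : 0 < 1 - r by rewrite subr_gt0.
  rewrite -[leRHS]mul1r ler_pdivlMr// mulrC.
  have -> : (1 - r) * \sum_(i < n) r ^+ i = 1 - r ^+ n.
    by rewrite -[1 - r]opprB mulNr -subrX1 opprB.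
  by rewrite gerBl exprn_ge0 ?ltW.
(* The constant [C] is 0 when [M] is, hence [C + 1]. *)
have C10 : 0 < (C + 1)^-1 by rewrite invr_gt0 ltr_wpDl.
move/cvgrPdist_lt : t0 => /(_ _ C10) [N _ NP].
have := NP N.+1 (leqnSn _); rewrite /= sub0r normrN => tN.
have := congr1 Num.norm (tBP N.+1 isT); rewrite normrM (gtr0_norm (P_gt0 _)) => E.
have := BC N.+1.
have : `|t N.+1| * `|B N.+1| <= (C + 1)^-1 * (P N.+1 * C) by rewrite ler_pM// ltW.
rewrite E ler_pdivlMl; last by rewrite ltr_wpDl.
by have := P_gt0 N.+1; rewrite mulrDl mul1r mulrC; lra.
Qed.

(** [al] and [ga] are the coordinates of a vector in the frame (line, vertical), and the maximum is
    the sup norm of its image in standard coordinates. The upper bound sums subexponential terms;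
    the lower bound needs a separate argument for vectors on the invariant line. *)
Lemma triangular_rate0 (al ga C : R) (s : nat -> R) :
  n%:R^-1 * ln (P n) @[n --> \oo] --> (0 : R) ->
  (forall n, `|s n| <= C) -> (al, ga) <> (0, 0) ->
  n%:R^-1 * ln (Num.max `|al * P n + ga * B n|
                        `|(al * P n + ga * B n) * s n + ga / P n|)
    @[n --> \oo] --> (0 : R).
Proof.
move=> PL sC alga; have [Ps Ps'] := rate0_subexp P_gt0 PL.
have M0 : 0 <= M by exact: le_trans (bM 0%N).
have C0 : 0 <= C by exact: le_trans (sC 0%N).
have P_ge0 n : 0 <= P n by rewrite ltW ?P_gt0.
have PV_ge0 n : 0 <= (P n)^-1 by rewrite invr_ge0.
have Bs : subexp (fun n => `|B n|).
  apply: (subexp_le off_diagonal_bound); apply: subexpM => //.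
    by move=> n; rewrite sumr_ge0// => i _; rewrite !mulr_ge0.
  apply: (@subexp_sum (fun i => M * ((P i)^-1 * (P i.+1)^-1))); apply: subexpZ => //;
    first by move=> n; rewrite mulr_ge0.
  by apply: (subexpM _ _ Ps' (subexpS Ps')) => // n; exact: PV_ge0.
pose W n := Num.max `|al * P n + ga * B n| `|(al * P n + ga * B n) * s n + ga / P n|.
change (n%:R^-1 * ln (W n) @[n --> \oo] --> (0 : R)).
have Wup n : W n <= (`|al| * P n + `|ga| * `|B n|) * (1 + C) + `|ga| * (P n)^-1.
  have h : `|al * P n + ga * B n| <= `|al| * P n + `|ga| * `|B n|.
    by rewrite (le_trans (ler_normD _ _))// !normrM (ger0_norm (P_ge0 n)).
  have X0 : 0 <= `|al| * P n + `|ga| * `|B n| by rewrite addr_ge0// mulr_ge0.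
  rewrite ge_max mulrDr mulr1; apply/andP; split.
    by rewrite (le_trans h)// -addrA lerDl addr_ge0// mulr_ge0.
  rewrite (le_trans (ler_normD _ _))// [in X in _ + X <= _]normrM normfV (ger0_norm (P_ge0
    n)).
  rewrite lerD2r normrM (le_trans (y := (`|al| * P n + `|ga| * `|B n|) * C))//.
    by rewrite ler_pM.
  by rewrite lerDr.
have Ws : subexp W.
  apply: (subexp_le Wup); apply: subexpD; last exact: subexpZ.
  apply: subexpM => //.
  - by move=> n; rewrite addr_ge0// mulr_ge0.
  - by move=> n; rewrite addr_ge0.
  - by apply: subexpD; exact: subexpZ.
  - exact: subexp_cst.
have [ga0|ga0] := eqVneq ga 0.
  have al0 : al != 0 by apply/eqP => al0; apply: alga; rewrite al0 ga0.
  have Wlo n : `|al| * P n <= W n.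
    by rewrite /W ga0 !mul0r !addr0 le_max normrM (ger0_norm (P_ge0 n)) lexx.
  have W0 n : 0 < W n by rewrite (lt_le_trans _ (Wlo n))// mulr_gt0 ?normr_gt0 ?P_gt0.
  apply: subexp_rate0 => //.
  apply: (@subexp_le _ (fun n => `|al|^-1 * (P n)^-1)); last by apply: subexpZ => //;
    rewrite invr_ge0.
  by move=> n; rewrite -invfM lef_pV2 ?posrE// mulr_gt0 ?normr_gt0 ?P_gt0.
(* the area spanned with the invariant direction is preserved *)
have Wlo n : `|ga| * (P n)^-1 <= W n * (1 + C).
  have -> : `|ga| * (P n)^-1 = `|((al * P n + ga * B n) * s n + ga / P n) - (al * P n + ga
    * B n) * s n|.
    by rewrite addrAC subrr add0r normrM normfV (ger0_norm (P_ge0 n)).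
  rewrite (le_trans (ler_normB _ _))// mulrDr mulr1 lerD//;
    first by rewrite le_max lexx orbT.
  by rewrite normrM ler_pM// le_max lexx.
have C1 : 0 < 1 + C by rewrite ltr_pwDl.
have W0 n : 0 < W n.
  by rewrite -(pmulr_lgt0 _ C1) (lt_le_trans _ (Wlo n))// mulr_gt0 ?normr_gt0 ?invr_gt0
    ?P_gt0.
apply: subexp_rate0 => //.
apply: (@subexp_le _ (fun n => (`|ga|^-1 * (1 + C)) * P n)); last first.
  by apply: subexpZ => //; rewrite mulr_ge0 ?invr_ge0// ltW.
move=> n; rewrite -mulrA ler_pdivlMl ?normr_gt0// -ler_pdivrMr ?P_gt0//.
rewrite mulrAC ler_pdivrMr ?W0// [leRHS]mulrC; exact: Wlo.
Qed.

End triangular.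
End subexponential.

(** * Green bundles *)

Section green.
Context (R : realType).
Implicit Types (x y : annulus R) (v w : 'rV[R]_2).

Lemma line00 (s : R) : line s 0 0 = 1.
Proof. by rewrite mxE. Qed.

Lemma line01 (s : R) : line s 0 1 = s.
Proof. by rewrite mxE. Qed.

Lemma vert00 : vert R 0 0 = 0.
Proof. by rewrite mxE. Qed.

Lemma vert01 : vert R 0 1 = 1.
Proof. by rewrite mxE. Qed.

Lemma transverse_vert (G : 'rV[R]_2) : transverse G (vert R) -> G 0 0 != 0.
Proof.
move=> GV; apply/eqP => G0.
have Gv : G = G 0 1 *: vert R by apply: row2P; rewrite mxE ?vert00 ?vert01 ?mulr0 ?mulr1.
have : (\rank (G + vert R)%MS <= 1)%N.
  rewrite (leq_trans (mxrankS (_ : (_ <= vert R)%MS))) ?rank_leq_row//.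
  by rewrite addsmx_sub submx_refl andbT; apply/sub_rVP; exists (G 0 1).
by move: GV; rewrite /transverse /row_full => /eqP ->.
Qed.

Lemma row_line (G : 'rV[R]_2) : G 0 0 != 0 -> G = G 0 0 *: line (G 0 1 / G 0 0).
Proof.
by move=> G0; apply: row2P; rewrite [RHS]mxE ?line00 ?line01 ?mulr1// mulrC divfK.
Qed.

(** The lower bound is [l 2] and not [l 1]: the strict inequality between these two will keep both
    limits off s_(-1). The sequences are shifted by one because their terms of index 0, which stand
    for the vertical, are unconstrained. *)
Lemma interlaced_limits (l u : nat -> R) :
  (forall n, (0 < n)%N -> [/\ l n < l n.+1, l n.+1 < u n.+1 & u n.+1 < u n]) ->
  [/\ u n @[n --> \oo] --> limn u, l n @[n --> \oo] --> limn l,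
      l 2%N <= limn l, limn l <= limn u & limn u <= u 1%N].
Proof.
move=> lu.
have up : nondecreasing_seq (fun n => l n.+1).
  by apply/nondecreasing_seqP => n; have [/ltW] := lu _ (ltn0Sn n).
have dn : nonincreasing_seq (fun n => u n.+1).
  by apply/nonincreasing_seqP => n; have [_ _ /ltW] := lu _ (ltn0Sn n).
have lt n : l n.+1 <= u n.+1.
  have [/ltW h1 /ltW h2 /ltW h3] := lu _ (ltn0Sn n).
  by rewrite (le_trans h1)// (le_trans h2).
have cl : cvgn (fun n => l n.+1).
  apply: nondecreasing_is_cvgn => //; exists (u 1%N) => _ [n _ <-].
  by rewrite (le_trans (lt n))//; exact: (dn 0%N n).
have cu : cvgn (fun n => u n.+1).
  apply: nonincreasing_is_cvgn => //; exists (l 1%N) => _ [n _ <-].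
  by rewrite (le_trans _ (lt n))//; exact: (up 0%N n).
have cu' : u n @[n --> \oo] --> limn (fun n => u n.+1).
  by rewrite -(cvg_shiftS u); exact: cu.
have cl' : l n @[n --> \oo] --> limn (fun n => l n.+1).
  by rewrite -(cvg_shiftS l); exact: cl.
have -> : limn u = limn (fun n => u n.+1) by exact: (cvg_lim (@Rhausdorff R) cu').
have -> : limn l = limn (fun n => l n.+1) by exact: (cvg_lim (@Rhausdorff R) cl').
split => //.
- exact: (nondecreasing_cvgn_le up cl 1%N).
- by apply: ler_lim => //; exact: nearW.
- exact: (nonincreasing_cvgn_ge dn cu 0%N).
Qed.

(** * The action of the derivative of a twist map on slopes *)

Section twist_map.
Variable f : annulus R -> annulus R.
Hypothesis ctf : conservative_twist_map f.
Local Notation g := (inverse_map f).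

Lemma ctm_bij : bijective f.
Proof. by case: ctf => -[]. Qed.

Lemma ctm_C1 : C1 f.
Proof. by case: ctf => -[]. Qed.

Lemma ctm_inverse_C1 : C1 g.
Proof. by case: ctf => -[]. Qed.

(* The charts only give local information; global continuity is read off the end
   of the isotopy. *)
Lemma ctm_homeomorphism : homeomorphism f.
Proof.
case: ctf => _ [H [_ HH _ <-]] _ _; apply: HH.
by rewrite ler01 lexx.
Qed.

Lemma ctm_continuous : continuous f.
Proof. by case: ctm_homeomorphism. Qed.

Lemma ctm_inverse_continuous : continuous g.
Proof. by case: ctm_homeomorphism. Qed.

Lemma ctm_fK : cancel f g. Proof. exact: inverse_mapK ctm_bij. Qed.
Lemma ctm_gK : cancel g f. Proof. exact: inverse_mapKV ctm_bij. Qed.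

Lemma slopeE k x : Gk f k x 0 0 != 0 -> slope f k x = Gk f k x 0 1 / Gk f k x 0 0.
Proof.
move=> G0; have E s : (Gk f k x == line s)%MS -> s = Gk f k x 0 1 / Gk f k x 0 0.
  move=> /andP[/sub_rVP[a Ga] _]; rewrite Ga !mxE /= mulr1 mulrAC divff ?mul1r//.
  by move: G0; rewrite Ga !mxE /= mulr1.
apply: E; apply: (@xgetPex _ 0 [set s : R | (Gk f k x == line s)%MS]).
exists (Gk f k x 0 1 / Gk f k x 0 0) => /=; apply/andP; split.
  by apply/sub_rVP; exists (Gk f k x 0 0); exact: row_line.
apply/sub_rVP; exists (Gk f k x 0 0)^-1.
by rewrite [X in _ *: X](row_line G0) scalerA mulVf// scale1r.
Qed.

Lemma Green_Gk k x : Green f x -> k != 0 -> Gk f k x 0 0 != 0.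
Proof. by move=> /(_ 0) /= [+ _] => /(_ k) h /h; exact: transverse_vert. Qed.

Lemma Green_iterz j x : Green f x -> Green f (iterz f j x).
Proof. by move=> Gx i; rewrite -(iterzD ctm_bij); exact: Gx. Qed.

Lemma Green_f x : Green f x -> Green f (f x).
Proof. exact: (@Green_iterz 1). Qed.

Lemma Green_slope x (n : nat) : Green f x -> (0 < n)%N ->
  [/\ slope f (- n%:Z) x < slope f (- n.+1%:Z) x,
      slope f (- n.+1%:Z) x < slope f n.+1%:Z x
    & slope f n.+1%:Z x < slope f n%:Z x].
Proof. by move=> /(_ 0) /= [_]; apply. Qed.

Lemma Green_limits x : Green f x ->
  [/\ slope f n%:Z x @[n --> \oo] --> s_plus f x,
      slope f (- n%:Z) x @[n --> \oo] --> s_minus f x,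
      slope f (- 2%:Z) x <= s_minus f x, s_minus f x <= s_plus f x
    & s_plus f x <= slope f 1%:Z x].
Proof.
move=> Gx.
exact: (@interlaced_limits (fun n => slope f (- n%:Z) x) (fun n => slope f n%:Z x)
  (fun n => @Green_slope x n Gx)).
Qed.

Lemma Gk_pushE k x : Gk f (k + 1) (f x) = Gk f k x *m Df f x.
Proof.
exact: (Gk_push ctm_bij ctm_C1 ctm_inverse_C1 k x).
Qed.

Definition twist x := Df f x 1 0.

Lemma twist_bounds : exists2 e, 0 < e & forall x, e < twist x < 1 / e.
Proof.
case: ctf => _ _ [e e0 te] _; exists e => // x.
have := te x; suff -> : (vert R *m Df f x) 0 0 = twist x by [].
by rewrite mulmx2E vert00 vert01 mul0r add0r mul1r.
Qed.

Lemma twist_gt0 x : 0 < twist x.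
Proof. by have [e e0 /(_ x) /andP[/(lt_trans e0)]] := twist_bounds. Qed.

(** [Df f x] sends G_(-1)(x) to the vertical at [f x], so the first coordinate of the image of (1,
    s_(-1)) vanishes. *)
Lemma Green_slopeN1 x : Green f x -> Df f x 0 0 = - twist x * slope f (-1) x.
Proof.
move=> Gx; have G0 := Green_Gk Gx (isT : (-1 : int) != 0).
have : (Gk f (-1) x *m Df f x) 0 0 = 0.
  rewrite -Gk_pushE addNr /Gk oppr0.
  by rewrite [iterz f 0 (f x)]/= (Df_id (f x)) mulmx1 vert00.
rewrite (row_line G0) -slopeE// -scalemxAl mxE => /eqP.
rewrite mulf_eq0 (negPf G0) /= mulmx2E line00 line01 mul1r -/(twist x).
by rewrite addr_eq0 => /eqP ->; rewrite mulNr mulrC.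
Qed.

Definition stretch (s : annulus R -> R) x := twist x * (s x - slope f (-1) x).

Lemma line_Df00 x s : Green f x -> (line s *m Df f x) 0 0 = twist x * (s - slope f (-1) x).
Proof.
move=> Gx; rewrite mulmx2E line00 line01 mul1r Green_slopeN1// -/(twist x); ring.
Qed.

(** The derivative acts on slopes by a homography with pole s_(-1). The image must not be the
    vertical, which excludes [k = -1]. *)
Lemma slope_push k x : Green f x -> k != 0 -> k + 1 != 0 ->
  slope f (k + 1) (f x) = (Df f x 0 1 + slope f k x * Df f x 1 1) / (twist x * (slope f k x
    - slope f (-1) x)).
Proof.
move=> Gx k0 k10; have G0 := Green_Gk Gx k0; have G1 := Green_Gk (Green_f Gx) k10.
rewrite slopeE// Gk_pushE (row_line G0) -slopeE// -scalemxAl.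
rewrite [X in X / _]mxE [X in _ / X]mxE line_Df00// -mulf_div divff// mul1r.
by rewrite mulmx2E line00 line01 mul1r.
Qed.

(** The homography is continuous off its pole, so the invariance of the family G_k passes to a limit
    slope that stays above s_(-1). *)
Lemma limit_slope_push x (k : nat -> int) (s s' : R) : Green f x ->
  (forall n, k n != 0) -> (forall n, k n + 1 != 0) ->
  slope f (k n) x @[n --> \oo] --> s -> slope f (k n + 1) (f x) @[n --> \oo] --> s' ->
  slope f (-1) x < s ->
  line s *m Df f x = (twist x * (s - slope f (-1) x)) *: line s'.
Proof.
move=> Gx k0 k10 ks ks' s1.
have p0 : twist x * (s - slope f (-1) x) != 0.
  by rewrite gt_eqF// mulr_gt0 ?twist_gt0// subr_gt0.
have E : s' = (Df f x 0 1 + s * Df f x 1 1) / (twist x * (s - slope f (-1) x)).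
  apply: (cvg_unique (@Rhausdorff R) ks').
  have -> : (fun n => slope f (k n + 1) (f x)) = (fun n => (Df f x 0 1 + slope f (k n) x *
    Df f x 1 1)
      / (twist x * (slope f (k n) x - slope f (-1) x))).
    by apply/funext => n; exact: slope_push.
  apply: cvgM; first by apply: cvgD; [exact: cvg_cst|apply: cvgMl].
  by apply: cvgV => //; apply: cvgMr; apply: cvgB => //; exact: cvg_cst.
apply: row2P; rewrite [RHS]mxE ?line00 ?line01 ?mulr1 ?line_Df00//.
by rewrite mulmx2E line00 line01 mul1r E [RHS]mulrCA divff// mulr1.
Qed.

Lemma s_minus_gt x : Green f x -> slope f (-1) x < s_minus f x.
Proof.
move=> Gx; have [_ _ h _ _] := Green_limits Gx.
by have [h1 _ _] := Green_slope Gx (ltn0Sn 0); exact: lt_le_trans h1 h.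
Qed.

Lemma s_plus_gt x : Green f x -> slope f (-1) x < s_plus f x.
Proof.
move=> Gx; have [_ _ _ h _] := Green_limits Gx.
exact: lt_le_trans (s_minus_gt Gx) h.
Qed.

Lemma s_plus_push x : Green f x ->
  line (s_plus f x) *m Df f x = stretch (s_plus f) x *: line (s_plus f (f x)).
Proof.
move=> Gx; have [c _ _ _ _] := Green_limits Gx.
have [c' _ _ _ _] := Green_limits (Green_f Gx).
have E n : n.+1%:Z + 1 = n.+2%:Z by rewrite -PoszD addn1.
have h1 : slope f n.+1%:Z x @[n --> \oo] --> s_plus f x.
  by rewrite (cvg_shiftS (fun n : nat => slope f n%:Z x)); exact: c.
have h2 : slope f (n.+1%:Z + 1) (f x) @[n --> \oo] --> s_plus f (f x).
  have -> : (fun n => slope f (n.+1%:Z + 1) (f x)) = (fun n => slope f n.+2%:Z (f x)).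
    by apply/funext => n; rewrite E.
  rewrite (cvg_shiftS (fun n : nat => slope f n.+1%:Z (f x))).
  by rewrite (cvg_shiftS (fun n : nat => slope f n%:Z (f x))); exact: c'.
refine (limit_slope_push Gx _ _ h1 h2 (s_plus_gt Gx)) => n; first by [].
by rewrite E.
Qed.

Lemma s_minus_push x : Green f x ->
  line (s_minus f x) *m Df f x = stretch (s_minus f) x *: line (s_minus f (f x)).
Proof.
move=> Gx; have [_ c _ _ _] := Green_limits Gx.
have [_ c' _ _ _] := Green_limits (Green_f Gx).
(* Starting at index -2 keeps the image index away from 0. *)
have E n : - n.+2%:Z + 1 = - n.+1%:Z by lia.
have h1 : slope f (- n.+2%:Z) x @[n --> \oo] --> s_minus f x.
  rewrite (cvg_shiftS (fun n : nat => slope f (- n.+1%:Z) x)).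
  by rewrite (cvg_shiftS (fun n : nat => slope f (- n%:Z) x)); exact: c.
have h2 : slope f (- n.+2%:Z + 1) (f x) @[n --> \oo] --> s_minus f (f x).
  have -> : (fun n => slope f (- n.+2%:Z + 1) (f x)) = (fun n => slope f (- n.+1%:Z) (f x)).
    by apply/funext => n; rewrite E.
  by rewrite (cvg_shiftS (fun n : nat => slope f (- n%:Z) (f x))); exact: c'.
refine (limit_slope_push Gx _ _ h1 h2 (s_minus_gt Gx)) => n; first by [].
by rewrite E.
Qed.

Definition det2 (A : 'M[R]_2) : R := A 0 0 * A 1 1 - A 0 1 * A 1 0.

Lemma ctm_det x : det2 (Df f x) = 1.
Proof.
apply: conservative_det.
- exact: C1_differentiable ctm_C1.
- exact: C1_Df_continuous ctm_C1.
- by case: ctf.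
Qed.

Lemma Df_gK x : Df f (g x) *m Df g x = 1%:M.
Proof.
by have := Df_iterzN ctm_bij ctm_C1 ctm_inverse_C1 (-1) x.
Qed.

(** Cramer's rule for a matrix of determinant 1: the inverse map twists negatively, within the same
    bounds. *)
Lemma Df_g10 x : Df g x 1 0 = - twist (g x).
Proof.
have D := ctm_det (g x); have E := Df_gK x.
have E0 := congr1 (fun A : 'M[R]_2 => A 1 0) E; have E1 := congr1 (fun A : 'M[R]_2 => A 0
  0) E.
move: D E0 E1; rewrite !mulmx2E !mxE /= /twist /det2.
set A := Df f _; set B := Df g _ => D E0 E1.
have -> : A 1 0 = A 1 0 * (A 0 0 * B 0 0 + A 0 1 * B 1 0) - A 0 0 * (A 1 0 * B 0 0 + A 1 1
  * B 1 0).
  by rewrite E0 E1 mulr0 subr0 mulr1.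
rewrite -[LHS]mul1r -D; ring.
Qed.

Lemma Df_g_det x : det2 (Df g x) = 1.
Proof.
have D := ctm_det (g x); have E := Df_gK x.
have -> : det2 (Df g x) = det2 (Df f (g x)) * det2 (Df g x) by rewrite D mul1r.
have -> : det2 (Df f (g x)) * det2 (Df g x) = det2 (Df f (g x) *m Df g x).
  by rewrite /det2 !mulmx2E; ring.
by rewrite E /det2 !mxE /=; ring.
Qed.

Lemma slope_pull (s : annulus R -> R) x : stretch s (g x) != 0 ->
  line (s (g x)) *m Df f (g x) = stretch s (g x) *: line (s (f (g x))) ->
  line (s x) *m Df g x = (stretch s (g x))^-1 *: line (s (g x)).
Proof.
move=> s0; rewrite ctm_gK => E.
have -> : line (s x) = (stretch s (g x))^-1 *: (line (s (g x)) *m Df f (g x)).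
  by rewrite E scalerA mulVf// scale1r.
by rewrite -scalemxAl -mulmxA Df_gK mulmx1.
Qed.

Lemma iterzN (n : nat) x : iterz f (- n%:Z) x = iter n g x.
Proof. by case: n. Qed.

Lemma Gk_iterz k x : Gk f k x *m Df (iterz f (- k)) x = vert R.
Proof.
rewrite /Gk -mulmxA.
have := Df_iterzN ctm_bij ctm_C1 ctm_inverse_C1 (- k) x.
by rewrite opprK => ->; rewrite mulmx1.
Qed.

(** G_k is by definition the image of the vertical under Df^k, so the opposite iterate brings it
    back to the vertical. *)
Lemma slope_iterz k x : Green f x -> k != 0 ->
  (line (slope f k x) *m Df (iterz f (- k)) x) 0 0 = 0.
Proof.
move=> Gx k0; have G0 := Green_Gk Gx k0.
have := congr1 (fun v : 'rV[R]_2 => v 0 0) (Gk_iterz k x).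
rewrite /= vert00 (row_line G0) -slopeE// -scalemxAl mxE => /eqP.
by rewrite mulf_eq0 (negPf G0) => /eqP.
Qed.
End twist_map.
End green.

(** * Growth along an invariant line *)

Section invariant_line.
Context (R : realType).
Implicit Types (x y : annulus R) (v w : 'rV[R]_2).

Lemma rowZE (a : R) v i : (a *: v) 0 i = a * v 0 i.
Proof. by rewrite mxE. Qed.

Lemma rowDE v w i : (v + w) 0 i = v 0 i + w 0 i.
Proof. by rewrite mxE. Qed.

Lemma rowNE v i : (- v) 0 i = - v 0 i.
Proof. by rewrite mxE. Qed.

Lemma norm_row2 v : `|v| = Num.max `|v 0 0| `|v 0 1|.
Proof.
apply/eqP; rewrite eq_le ge_max !mx_norm_ge_entry !andbT.
have -> : v = pt (v 0 0) (v 0 1) by apply: row2P; rewrite mxE.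
by rewrite pt_norm// !mxE /= le_max lexx ?orbT.
Qed.

(** The map is abstract so that everything applies to [f] with factor p and to its inverse with
    factor 1 / p taken at the preimage. *)
Variables (h : annulus R -> annulus R) (K : set (annulus R)).
Variables (s q : annulus R -> R) (C : R).
Hypothesis dh : differentiable_map h.
Hypothesis Kh : forall x, K x -> K (h x).
Hypothesis q_gt0 : forall x, K x -> 0 < q x.
Hypothesis sC : forall x, K x -> `|s x| <= C.
Hypothesis line_Dh : forall x, K x -> line (s x) *m Df h x = q x *: line (s (h x)).

Lemma iter_stable n x : K x -> K (iter n h x).
Proof. by move=> Kx; elim: n => //= n IHn; exact: Kh. Qed.

Lemma Df_iterS n x : Df (iter n.+1 h) x = Df (iter n h) x *m Df h (iter n h x).
Proof. exact: (Df_comp x (@differentiable_map_iter R h n dh) dh). Qed.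

Lemma Df_iter0 x : Df (iter 0 h) x = 1%:M :> 'M[R]_2.
Proof. exact: Df_id. Qed.

Definition line_factor n x := \prod_(i < n) q (iter i h x).

Lemma line_factorS n x : line_factor n.+1 x = line_factor n x * q (iter n h x).
Proof. by rewrite /line_factor big_ord_recr. Qed.

Lemma line_factor_gt0 n x : K x -> 0 < line_factor n x.
Proof. by move=> Kx; apply: prodr_gt0 => i _; apply: q_gt0; exact: iter_stable. Qed.

Lemma ln_line_factor n x : K x -> ln (line_factor n x) = birkhoff_sum h (fun y => ln (q y))
  n x.
Proof.
move=> Kx; rewrite /birkhoff_sum; elim: n => [|n IHn].
  by rewrite /line_factor !big_ord0 ln1.
rewrite line_factorS lnM ?posrE ?line_factor_gt0//; last exact/q_gt0/iter_stable.
by rewrite IHn big_ord_recr.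
Qed.

Lemma line_Df_iter n x : K x ->
  line (s x) *m Df (iter n h) x = line_factor n x *: line (s (iter n h x)).
Proof.
move=> Kx; elim: n => [|n IHn].
  by rewrite Df_iter0 mulmx1 /line_factor big_ord0 scale1r.
rewrite Df_iterS mulmxA IHn -scalemxAl line_Dh; last exact: iter_stable.
by rewrite scalerA -line_factorS.
Qed.

Lemma line_norm_bounds (t : R) : `|t| <= C -> 1 <= `|line t| <= 1 + C.
Proof.
move=> tC; have C0 : 0 <= C by exact: le_trans tC.
rewrite norm_row2 line00 line01 normr1 le_max lexx ge_max lerDl C0 /=.
by rewrite (le_trans tC)// lerDr.
Qed.

Lemma line_growth (L c : R) x : K x -> c != 0 ->
  n%:R^-1 * birkhoff_sum h (fun y => ln (q y)) n x @[n --> \oo] --> L ->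
  n%:R^-1 * ln `|(c *: line (s x)) *m Df (iter n h) x| @[n --> \oo] --> L.
Proof.
move=> Kx c0 qL; pose u n := `|c| * `|line (s (iter n h x))|.
have c_gt0 : 0 < `|c| by rewrite normr_gt0.
have lb n := line_norm_bounds (sC (iter_stable n Kx)).
have u0 n : 0 < u n.
  by rewrite mulr_gt0//; have /andP[+ _] := lb n; apply: lt_le_trans.
have rate_u : n%:R^-1 * ln (u n) @[n --> \oo] --> (0 : R).
  apply: subexp_rate0 => //.
    apply: (@subexp_le _ _ (fun=> `|c| * (1 + C))); last exact: subexp_cst.
    by move=> n; rewrite ler_pM2l//; have /andP[_] := lb n.
  apply: (@subexp_le _ _ (fun=> `|c|^-1)); last exact: subexp_cst.
  move=> n; rewrite invfM -[leRHS]mulr1 ler_pM2l ?invr_gt0//.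
  by rewrite invf_le1; have /andP[l1 _] := lb n => //; exact: lt_le_trans l1.
rewrite -[L]addr0.
have -> : (fun n => n%:R^-1 * ln `|(c *: line (s x)) *m Df (iter n h) x|) =
    (fun n => n%:R^-1 * birkhoff_sum h (fun y => ln (q y)) n x + n%:R^-1 * ln (u n)).
  apply/funext => n; rewrite -scalemxAl line_Df_iter// !normrZ -mulrDr.
  rewrite (gtr0_norm (line_factor_gt0 n Kx)) mulrCA lnM ?posrE ?line_factor_gt0//;
    last exact: u0.
  by rewrite ln_line_factor.
exact: cvgD.
Qed.

Variable M : R.
Hypothesis det_Dh : forall x, K x -> det2 (Df h x) = 1.
Hypothesis Dh10 : forall x, K x -> `|Df h x 1 0| <= M.

Lemma vert_Dh x : K x ->
  vert R *m Df h x = Df h x 1 0 *: line (s (h x)) + (q x)^-1 *: vert R.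
Proof.
move=> Kx; have L := line_Dh Kx.
have L0 := congr1 (fun v : 'rV[R]_2 => v 0 0) L; have L1 := congr1 (fun v : 'rV[R]_2 => v 0
  1) L.
have D := det_Dh Kx; have q0 := q_gt0 Kx.
move: L0 L1; rewrite /= !mulmx2E !rowZE !line00 !line01 !mul1r mulr1 => L0 L1.
apply: row2P; rewrite mulmx2E rowDE !rowZE ?line00 ?line01 ?vert00 ?vert01.
  by rewrite mul0r add0r mul1r !mulr1 mulr0 addr0.
rewrite mul0r add0r mul1r mulr1.
apply: (mulfI (lt0r_neq0 q0)); rewrite mulrDr divff ?gt_eqF// mulrCA -L1 -{1}L0 -D /det2.
ring.
Qed.

Definition off_diagonal n x : R := (vert R *m Df (iter n h) x) 0 0.

Lemma vert_Df_iter n x : K x -> vert R *m Df (iter n h) x =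
  off_diagonal n x *: line (s (iter n h x)) + (line_factor n x)^-1 *: vert R.
Proof.
move=> Kx.
(* The coefficient on the line is forced to be [off_diagonal], since [line] has first coordinate 1
   and [vert] has 0. *)
suff [b E] : exists b, vert R *m Df (iter n h) x =
    b *: line (s (iter n h x)) + (line_factor n x)^-1 *: vert R.
  by rewrite /off_diagonal E rowDE !rowZE line00 vert00 mulr0 addr0 mulr1.
elim: n => [|n [b E]].
  exists 0; rewrite scale0r add0r /line_factor big_ord0 invr1 scale1r.
  by rewrite Df_iter0 mulmx1.
have Kn := iter_stable n Kx.
exists (b * q (iter n h x) + (line_factor n x)^-1 * Df h (iter n h x) 1 0).
rewrite Df_iterS mulmxA E mulmxDl -!scalemxAl line_Dh// vert_Dh// scalerDr !scalerA addrA
  -scalerDl.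
by rewrite line_factorS invfM.
Qed.

Lemma off_diagonalS n x : K x -> off_diagonal n.+1 x =
  off_diagonal n x * q (iter n h x) + Df h (iter n h x) 1 0 / line_factor n x.
Proof.
move=> Kx; have Kn := iter_stable n Kx.
rewrite {1}/off_diagonal Df_iterS mulmxA vert_Df_iter// mulmxDl -!scalemxAl line_Dh//
  vert_Dh//.
rewrite rowDE !rowZE rowDE !rowZE !line00 vert00.
by rewrite !mulr1 mulr0 addr0 [_^-1 * _]mulrC.
Qed.

Lemma off_diagonal0 x : off_diagonal 0 x = 0.
Proof. by rewrite /off_diagonal Df_iter0 mulmx1 vert00. Qed.

Lemma line_factor0 x : line_factor 0 x = 1.
Proof. by rewrite /line_factor big_ord0. Qed.

Lemma line_rate_eq x : K x ->
  (fun n => n%:R^-1 * ln (line_factor n x)) = (fun n => n%:R^-1 * birkhoff_sum h (fun y =>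
    ln (q y)) n x).
Proof. by move=> Kx; apply/funext => n; rewrite ln_line_factor. Qed.

(* t n is the slope that Df^n sends to the vertical. *)
Lemma invariant_rate_le0 (L : R) (t : nat -> R) x : K x ->
  n%:R^-1 * birkhoff_sum h (fun y => ln (q y)) n x @[n --> \oo] --> L ->
  t n @[n --> \oo] --> s x ->
  (forall n, (0 < n)%N -> (line (t n) *m Df (iter n h) x) 0 0 = 0) -> L <= 0.
Proof.
move=> Kx; rewrite -line_rate_eq// => PL ts tB.
apply: (@triangular_rate_le0 _ (fun n => line_factor n x) (fun n => off_diagonal n x)
  (fun n => Df h (iter n h x) 1 0) (fun n => q (iter n h x)) _ _ _ _ _ M _ L (fun n => s x
    - t n)) => //.
- exact: line_factor0.
- by move=> n; exact: line_factorS.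
- by move=> n; apply: q_gt0; exact: iter_stable.
- exact: off_diagonal0.
- by move=> n; exact: off_diagonalS.
- by move=> n; apply: Dh10; exact: iter_stable.
- by rewrite -(subrr (s x)); apply: cvgB => //; exact: cvg_cst.
move=> n /tB.
(* In the triangular frame, the vanishing of the first coordinate reads [(s x - t n) * off_diagonal
   n x = line_factor n x]. *)
have -> : line (t n) = line (s x) - (s x - t n) *: vert R.
  apply: row2P; rewrite !mxE /=; ring.
rewrite mulmxBl -scalemxAl line_Df_iter// rowDE rowNE !rowZE line00 mulr1.
by rewrite -/(off_diagonal n x) => /eqP; rewrite subr_eq0 => /eqP.
Qed.

Lemma invariant_rate0 v x : K x -> v != 0 ->
  n%:R^-1 * birkhoff_sum h (fun y => ln (q y)) n x @[n --> \oo] --> (0 : R) ->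
  n%:R^-1 * ln `|v *m Df (iter n h) x| @[n --> \oo] --> (0 : R).
Proof.
move=> Kx v0; rewrite -line_rate_eq// => PL.
have := @triangular_rate0 _ (fun n => line_factor n x) (fun n => off_diagonal n x)
  (fun n => Df h (iter n h x) 1 0) (fun n => q (iter n h x)) (line_factor0 x)
  (fun n => line_factorS n x) (fun n => q_gt0 (iter_stable n Kx)) (off_diagonal0 x)
  (fun n => off_diagonalS n Kx) M (fun n => Dh10 (iter_stable n Kx))
  (v 0 0) (v 0 1 - s x * v 0 0) C (fun n => s (iter n h x)) PL
  (fun n => sC (iter_stable n Kx)).
have -> : (fun n => n%:R^-1 * ln `|v *m Df (iter n h) x|) = (fun n => n%:R^-1 * ln (Num.max
    `|v 0 0 * line_factor n x + (v 0 1 - s x * v 0 0) * off_diagonal n x|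
    `|(v 0 0 * line_factor n x + (v 0 1 - s x * v 0 0) * off_diagonal n x) * s (iter n h x)
      + (v 0 1 - s x * v 0 0) / line_factor n x|)).
  apply/funext => n; congr (_ * ln _).
  have {1}-> : v = v 0 0 *: line (s x) + (v 0 1 - s x * v 0 0) *: vert R.
    by apply: row2P; rewrite !mxE /=; ring.
  rewrite mulmxDl -!scalemxAl line_Df_iter// vert_Df_iter// norm_row2.
  rewrite !rowDE !rowZE !rowDE !rowZE line00 line01 vert00 vert01.
  by apply: congr2; apply: congr1; ring.
apply => -[v00 v01]; move/negP: v0; apply; apply/eqP/row2P; rewrite mxE//.
by move: v01; rewrite v00 mulr0 subr0.
Qed.

End invariant_line.

(** * The area between two invariant lines *)

Section two_lines.
Context (R : realType).
Variables (h : annulus R -> annulus R) (K : set (annulus R)).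
Variables (s t q r : annulus R -> R) (C : R).
Hypothesis Kh : forall x, K x -> K (h x).
Hypothesis q_gt0 : forall x, K x -> 0 < q x.
Hypothesis r_gt0 : forall x, K x -> 0 < r x.
Hypothesis sC : forall x, K x -> `|s x| <= C.
Hypothesis tC : forall x, K x -> `|t x| <= C.
Hypothesis s_Dh : forall x, K x -> line (s x) *m Df h x = q x *: line (s (h x)).
Hypothesis t_Dh : forall x, K x -> line (t x) *m Df h x = r x *: line (t (h x)).
Hypothesis det_Dh : forall x, K x -> det2 (Df h x) = 1.

(** [s x - t x] is the area spanned by (1, t) and (1, s), and the determinant is 1. *)
Lemma line_area x : K x -> q x * r x * (s (h x) - t (h x)) = s x - t x.
Proof.
move=> Kx.
have S0 := congr1 (fun v : 'rV[R]_2 => v 0 0) (s_Dh Kx).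
have S1 := congr1 (fun v : 'rV[R]_2 => v 0 1) (s_Dh Kx).
have T0 := congr1 (fun v : 'rV[R]_2 => v 0 0) (t_Dh Kx).
have T1 := congr1 (fun v : 'rV[R]_2 => v 0 1) (t_Dh Kx).
move: S0 S1 T0 T1; rewrite /= !mulmx2E !rowZE !line00 !line01 !mul1r !mulr1 => S0 S1 T0 T1.
have -> : q x * r x * (s (h x) - t (h x)) = r x * (q x * s (h x)) - q x * (r x * t (h x))
  by ring.
rewrite -S1 -T1 -S0 -T0 -[RHS]mulr1 -(det_Dh Kx) /det2; ring.
Qed.

Lemma line_area_iter n x : K x ->
  line_factor h q n x * line_factor h r n x * (s (iter n h x) - t (iter n h x)) = s x - t x.
Proof.
move=> Kx; elim: n => [|n IHn]; first by rewrite !line_factor0 !mul1r.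
rewrite !line_factorS mulrACA -[LHS]mulrA iterS line_area//; exact: (iter_stable Kh).
Qed.

(** The product of the two factors is the initial area divided by a gap of slopes of at most
    [2 * C], hence is bounded below. The gap may become small along the orbit, so the reverse
    inequality is obtained from the inverse map. *)
Lemma two_lines_rate_ge0 (L1 L2 : R) x : K x -> t x < s x ->
  n%:R^-1 * birkhoff_sum h (fun y => ln (q y)) n x @[n --> \oo] --> L1 ->
  n%:R^-1 * birkhoff_sum h (fun y => ln (r y)) n x @[n --> \oo] --> L2 ->
  0 <= L1 + L2.
Proof.
move=> Kx ts; rewrite -(line_rate_eq Kh q_gt0)// -(line_rate_eq Kh r_gt0)// => c1 c2.
have c12 : n%:R^-1 * ln (line_factor h q n x) + n%:R^-1 * ln (line_factor h r n x)
  @[n --> \oo] --> L1 + L2 by exact: cvgD.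
rewrite leNgt; apply/negP => L0.
pose c := ln ((s x - t x) / (C + C + 1)).
have C0 : 0 <= C by exact: le_trans (sC Kx).
have C1 : 0 < C + C + 1 by rewrite ltr_wpDl// addr_ge0.
have st0 : 0 < s x - t x by rewrite subr_gt0.
have lb n : c <= ln (line_factor h q n x) + ln (line_factor h r n x).
  have q0 := line_factor_gt0 Kh q_gt0 n Kx; have r0 := line_factor_gt0 Kh r_gt0 n Kx.
  rewrite -lnM ?posrE// ler_ln ?posrE ?divr_gt0 ?mulr_gt0// ler_pdivrMr//.
  rewrite -(line_area_iter n Kx) ler_pM2l ?mulr_gt0//.
  have Kn := iter_stable Kh n Kx.
  have := ler_norm (s (iter n h x)); have := ler_norm (- t (iter n h x)).
  have := sC Kn; have := tC Kn; rewrite normrN; lra.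
have cn : n%:R^-1 * c @[n --> \oo] --> (0 : R).
  rewrite -[X in _ --> X](mul0r c); apply: cvgMl.
  apply/cvgrPdist_lt => e e0; have := near_infty_natSinv_lt (PosNum e0).
  move=> [N _ NP]; exists N.+1 => // -[//|n] /= Nn.
  by rewrite sub0r normrN gtr0_norm ?invr_gt0// NP.
move: L0; apply/negP; rewrite -leNgt.
apply: (ler_cvg_to cn c12).
by apply: nearW => n; rewrite -[leRHS]mulrDr ler_wpM2l// invr_ge0.
Qed.

End two_lines.

Lemma cvg_oppE (R : realType) (u : nat -> R) (l : R) :
  - u n @[n --> \oo] --> l <-> u n @[n --> \oo] --> - l.
Proof.
split=> c; last by rewrite -[l]opprK; exact: cvgN.
have -> : (fun n => u n) = (fun n => - - u n) by apply/funext => n; rewrite opprK.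
exact: cvgN.
Qed.

Section probability_facts.
Context (R : realType) (d : measure_display) (T : measurableType d).
Variable P : probability T R.

Lemma ae_exists (Q : T -> Prop) : {ae P, forall x, Q x} -> exists x, Q x.
Proof.
move=> [N [mN N0 QN]]; apply: contrapT => nQ.
have NT : N = setT.
  by apply/seteqP; split => // x _; apply: QN => Qx; apply: nQ; exists x.
have := @probability_setT _ _ _ P; rewrite -NT => P1.
by move: N0; rewrite [LHS]P1 => /eqP; rewrite onee_eq0.
Qed.

Lemma ae_imply (Q Q' : T -> Prop) : {ae P, forall x, Q x} ->
  (forall x, Q x -> Q' x) -> {ae P, forall x, Q' x}.
Proof. by move=> q0 QQ; apply: filterS q0. Qed.

Lemma ae_imply3 (Q0 Q1 Q2 Q : T -> Prop) : {ae P, forall x, Q0 x} ->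
  {ae P, forall x, Q1 x} -> {ae P, forall x, Q2 x} ->
  (forall x, Q0 x -> Q1 x -> Q2 x -> Q x) -> {ae P, forall x, Q x}.
Proof. by move=> q0 q1 q2 QQ; apply: filterS3 q0 q1 q2. Qed.

Lemma probability1_ae (B : set T) : measurable B -> P B = 1%E -> {ae P, forall x, B x}.
Proof.
move=> mB B1; exists (~` B); split; [exact: measurableC| |exact: subset_refl].
by rewrite probability_setC// B1 subee.
Qed.
End probability_facts.

(** * Averages over the support *)

Section support_in_Green.
Context (R : realType).
Notation A := (annulus R).
Notation bA := (borel_annulus R).
Variables (f : A -> A) (mu : probability bA R).
Hypothesis ctf : conservative_twist_map f.
Hypothesis finv : invariant_measure f mu.
Hypothesis ferg : ergodic_measure f mu.
Hypothesis cK : compact (measure_supp mu).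
Hypothesis KG : measure_supp mu `<=` Green f.
Local Notation g := (inverse_map f).
Local Notation K := (measure_supp mu).

Lemma supp_f x : K (f x) <-> K x.
Proof.
exact: (measure_supp_invariant (ctm_continuous ctf) (ctm_inverse_continuous ctf)
  (ctm_fK ctf) (ctm_gK ctf) finv).
Qed.

Lemma supp_g x : K (g x) <-> K x.
Proof. by rewrite -supp_f (ctm_gK ctf). Qed.

Lemma measurable_supp : measurable (K : set bA).
Proof. exact: measurable_measure_supp. Qed.

(** Continuity holds in the annulus and not merely along the support: [Gk] is continuous everywhere
    and its first coordinate does not vanish at [x]. *)
Lemma slope_quotient_continuous k x : K x -> k != 0 ->
  {for x, continuous (fun y => Gk f k y 0 1 / Gk f k y 0 0)}.
Proof.
move=> Kx k0; have G0 := Green_Gk (KG Kx) k0.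
have c i := @Gk_continuous R f (ctm_C1 ctf) (ctm_inverse_C1 ctf) (ctm_continuous ctf)
  (ctm_inverse_continuous ctf) k i x.
by apply: cvgM; [exact: c|apply: cvgV => //; exact: c].
Qed.

Lemma slope_quotient k x : K x -> k != 0 -> slope f k x = Gk f k x 0 1 / Gk f k x 0 0.
Proof. by move=> Kx k0; apply: slopeE; apply: Green_Gk => //; exact: KG. Qed.

Lemma measurable_slope k : k != 0 -> measurable_fun (K : set bA) (slope f k).
Proof.
move=> k0.
apply: (@eq_measurable_fun _ _ bA _ K (fun y => Gk f k y 0 1 / Gk f k y 0 0)).
  by move=> x; rewrite inE => Kx; rewrite slope_quotient.
apply: continuous_measurable_fun_on; first exact: measurable_supp.
by move=> x Kx; exact: slope_quotient_continuous.
Qed.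

Lemma slope_bounded k : k != 0 -> exists C, forall x, K x -> `|slope f k x| <= C.
Proof.
move=> k0.
have [C CP] := compact_bounded_on cK (fun x Kx => slope_quotient_continuous Kx k0).
by exists C => x Kx; rewrite slope_quotient//; exact: CP.
Qed.

(** A continuous positive function on a compact set has a bounded inverse. Every invariant slope
    lies above s_(-2), so this also separates it uniformly from s_(-1). *)
Lemma slope_gap_bounded : exists2 c, 0 < c & forall x, K x ->
  c <= slope f (- 2%:Z) x - slope f (-1) x.
Proof.
have m1 : (-1 : int) != 0 by []. have m2 : - 2%:Z != 0 by [].
pose gap x := slope f (- 2%:Z) x - slope f (-1) x.
have gap_gt0 x : K x -> 0 < gap x.
  by move=> Kx; have [h _ _] := Green_slope (KG Kx) (ltn0Sn 0); rewrite subr_gt0.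
pose G k y := Gk f k y 0 1 / Gk f k y 0 0.
have gapE x : K x -> gap x = G (- 2%:Z) x - G (-1) x.
  by move=> Kx; rewrite /gap !slope_quotient.
have [C CP] : exists C, forall x, K x -> `|(G (- 2%:Z) x - G (-1) x)^-1| <= C.
  apply: compact_bounded_on => // x Kx; apply: cvgV.
    by rewrite -gapE// gt_eqF// gap_gt0.
  apply: cvgB; exact: slope_quotient_continuous.
exists (`|C| + 1)^-1 => [|x Kx]; first by rewrite invr_gt0 ltr_wpDl.
have := CP x Kx; rewrite -gapE// => gC; have g0 := gap_gt0 x Kx.
have C1 : 0 < `|C| + 1 by rewrite ltr_wpDl.
rewrite -/(gap x) -[gap x]invrK lef_pV2 ?posrE ?invr_gt0//.
by rewrite (le_trans (ler_norm _))// (le_trans gC)// (le_trans (ler_norm _))// lerDl.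
Qed.

Section invariant_slope.
Variable s : A -> R.
Hypothesis ms : measurable_fun (K : set bA) s.
Hypothesis s_ge : forall x, K x -> slope f (- 2%:Z) x <= s x.
Hypothesis s_le : forall x, K x -> s x <= slope f 1%:Z x.
Hypothesis s_push : forall x, K x -> line (s x) *m Df f x = stretch f s x *: line (s (f x)).

Lemma s_bounded : exists C, forall x, K x -> `|s x| <= C.
Proof.
have [C1 h1] := slope_bounded (isT : 1%:Z != 0).
have [C2 h2] := slope_bounded (isT : - 2%:Z != 0).
exists (C1 + C2) => x Kx; have := h1 x Kx; have := h2 x Kx.
have := s_ge Kx; have := s_le Kx; rewrite !ler_norml => a b /andP[c d] /andP[e i].
by apply/andP; split; lra.
Qed.

Lemma s_gt x : K x -> slope f (-1) x < s x.
Proof.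
move=> Kx; have [h _ _] := Green_slope (KG Kx) (ltn0Sn 0).
exact: lt_le_trans h (s_ge Kx).
Qed.

Lemma stretch_gt0 x : K x -> 0 < stretch f s x.
Proof. by move=> Kx; rewrite /stretch mulr_gt0 ?twist_gt0// subr_gt0 s_gt. Qed.

Lemma stretch_bounds : exists c C, 0 < c /\ forall x, K x -> c <= stretch f s x <= C.
Proof.
have [e e0 te] := twist_bounds ctf; have [c c0 cP] := slope_gap_bounded.
have [C sC] := s_bounded; have [C1 h1] := slope_bounded (isT : (-1 : int) != 0).
exists (e * c), (1 / e * (C + C1)); split; first exact: mulr_gt0.
move=> x Kx; have /andP[t1 t2] := te x; have := cP x Kx; have := s_ge Kx => a b.
have sg := s_gt Kx; rewrite /stretch; apply/andP; split.
  by apply: ler_pM => //; [exact: ltW|exact: ltW|exact: ltW|lra].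
apply: ler_pM => //; [by rewrite ltW// (lt_trans e0)|by rewrite subr_ge0 ltW|exact: ltW|].
have := sC x Kx; have := h1 x Kx; rewrite !ler_norml => /andP[? ?] /andP[? ?]; lra.
Qed.

(** Slopes are controlled on the support only; the extension by 0 gives a function that is bounded
    and measurable on the whole space. *)
Definition log_stretch : A -> R := (fun x => ln (stretch f s x)) \_ K.

Lemma log_stretchE x : K x -> log_stretch x = ln (stretch f s x).
Proof. by move=> Kx; rewrite /log_stretch patchE mem_set. Qed.

Lemma log_stretch_out x : ~ K x -> log_stretch x = 0.
Proof. by move=> nK; rewrite /log_stretch patchE memNset. Qed.

Lemma log_stretch_bounded : exists C, forall x, `|log_stretch x| <= C.
Proof.
have [c [C [c0 cC]]] := stretch_bounds; exists (`|ln c| + `|ln C|) => x.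
rewrite /log_stretch patchE; case: ifPn => [|_]; last by rewrite normr0 addr_ge0.
rewrite inE => /cC /andP[h1 h2]; have s0 := lt_le_trans c0 h1.
have : ln c <= ln (stretch f s x) by rewrite ler_ln.
have : ln (stretch f s x) <= ln C by rewrite ler_ln// posrE (lt_le_trans s0).
have := ler_norm (ln C); have := ler_norm (- ln c); rewrite normrN.
have := normr_ge0 (ln C); have := normr_ge0 (ln c).
by rewrite ler_norml => *; apply/andP; split; lra.
Qed.

Lemma measurable_twist : measurable_fun (K : set bA) (twist f).
Proof.
apply: continuous_measurable_fun_on; first exact: measurable_supp.
by move=> x _; exact: (C1_Df_continuous (ctm_C1 ctf)).
Qed.

Lemma measurable_log_stretch : measurable_fun setT (log_stretch : bA -> R).
Proof.
apply/(measurable_restrictT _ measurable_supp).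
apply: measurableT_comp; first exact: measurable_ln.
apply: measurable_funM; first exact: measurable_twist.
by apply: measurable_funB => //; exact: measurable_slope.
Qed.

Definition mean_log_stretch : R := \int[mu]_x (log_stretch x).

Lemma invariant_g (B : set bA) : measurable B -> mu (g @^-1` B) = mu B.
Proof.
move=> mB; rewrite -finv; last first.
  have := continuous_measurable_annulus (ctm_inverse_continuous ctf) measurableT mB.
  by rewrite setTI.
by congr (mu _); apply/seteqP; split => x /=; rewrite (ctm_fK ctf).
Qed.

Lemma ergodic_g (B : set bA) : measurable B -> g @^-1` B = B -> mu B = 0%E \/ mu B = 1%E.
Proof.
move=> mB gB; apply: ferg => //; rewrite -[in LHS]gB.
by apply/seteqP; split => x /=; rewrite (ctm_fK ctf).
Qed.

(** Backwards, Birkhoff's theorem is applied to [log_stretch \o g], whose integral is the same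
    because [g] preserves [mu]. Invariance of the support then replaces [log_stretch] by the
    logarithm along whole orbits. *)
Lemma log_stretch_averages : {ae mu, forall x,
  [/\ K x,
    n%:R^-1 * birkhoff_sum f (fun y => ln (stretch f s y)) n x @[n --> \oo] -->
      mean_log_stretch
  & n%:R^-1 * birkhoff_sum g (fun y => ln (stretch f s (g y))^-1) n x @[n --> \oo] --> -
    mean_log_stretch]}.
Proof.
have [C bC] := log_stretch_bounded.
have mf := continuous_measurable_annulus (ctm_continuous ctf).
have mg := continuous_measurable_annulus (ctm_inverse_continuous ctf).
have B1 := birkhoff_ergodic mf finv ferg measurable_log_stretch bC.
have mlg : measurable_fun setT (log_stretch \o g : bA -> R).
  exact: (measurableT_comp measurable_log_stretch mg).
have B2 := birkhoff_ergodic mg invariant_g ergodic_g mlg (fun x => bC (g x)).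
have I2 := invariant_Rintegral mg invariant_g measurable_log_stretch bC.
have B0 : {ae mu, forall x, K x} by exact: measure_supp_full.
apply: (ae_imply3 B0 B1 B2) => x Kx b1 b2; split; first exact: Kx.
  rewrite (_ : (fun n => _) = (fun n => n%:R^-1 * birkhoff_sum f log_stretch n x));
    first exact: b1.
  apply/funext => n; congr (_ * _); apply: eq_bigr => i _.
  exact/esym/log_stretchE/(iter_stable (fun y => (supp_f y).2) i Kx).
rewrite (_ : (fun n => _) = (fun n => - (n%:R^-1 * birkhoff_sum g (log_stretch \o g) n
  x))); last first.
  apply/funext => n; rewrite -mulrN; congr (_ * _); rewrite /birkhoff_sum -sumrN.
  apply: eq_bigr => i _; have Kgi : K (g (iter i g x)).
    exact: (supp_g _).2 (iter_stable (fun y => (supp_g y).2) i Kx).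
  rewrite [in RHS]/comp (log_stretchE Kgi) lnV; first exact: erefl.
  by rewrite posrE; exact: stretch_gt0.
by apply: cvgN; rewrite /mean_log_stretch -I2.
Qed.

Lemma line_pull x : K x ->
  line (s x) *m Df g x = (stretch f s (g x))^-1 *: line (s (g x)).
Proof.
move=> Kx; have Kg := (supp_g x).2 Kx.
by apply: slope_pull => //; [rewrite gt_eqF// stretch_gt0|exact: s_push].
Qed.

Lemma Df_g_bound : exists M : R, forall x, `|Df g x 1 0| <= M.
Proof.
have [e e0 te] := twist_bounds ctf; exists (1 / e) => x.
by rewrite Df_g10// normrN gtr0_norm ?twist_gt0//; have /andP[_ /ltW] := te (g x).
Qed.

Lemma Df_f_bound : exists M : R, forall x, `|Df f x 1 0| <= M.
Proof.
have [e e0 te] := twist_bounds ctf; exists (1 / e) => x.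
by rewrite -/(twist f x) gtr0_norm ?twist_gt0//; have /andP[_ /ltW] := te x.
Qed.

End invariant_slope.

Definition invariant_slope (s : A -> R) := [/\ measurable_fun (K : set bA) s,
  forall x, K x -> slope f (- 2%:Z) x <= s x,
  forall x, K x -> s x <= slope f 1%:Z x &
  forall x, K x -> line (s x) *m Df f x = stretch f s x *: line (s (f x))].

Lemma invariant_slope_plus : invariant_slope (s_plus f).
Proof.
split=> [|x Kx|x Kx|x Kx].
- apply: (@measurable_fun_cvg _ bA _ K (fun n => slope f n.+1%:Z)).
    by move=> n; exact: measurable_slope.
  move=> x Kx; have [c _ _ _ _] := Green_limits (KG Kx).
  by rewrite (cvg_shiftS (fun n : nat => slope f n%:Z x)); exact: c.
- by have [_ _ h1 h2 _] := Green_limits (KG Kx); exact: le_trans h1 h2.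
- by have [] := Green_limits (KG Kx).
- by apply: s_plus_push => //; exact: KG.
Qed.

Lemma invariant_slope_minus : invariant_slope (s_minus f).
Proof.
split=> [|x Kx|x Kx|x Kx].
- apply: (@measurable_fun_cvg _ bA _ K (fun n => slope f (- n.+1%:Z))).
    by move=> n; exact: measurable_slope.
  move=> x Kx; have [_ c _ _ _] := Green_limits (KG Kx).
  by rewrite (cvg_shiftS (fun n : nat => slope f (- n%:Z) x)); exact: c.
- by have [] := Green_limits (KG Kx).
- by have [_ _ _ h1 h2] := Green_limits (KG Kx); exact: le_trans h1 h2.
- by apply: s_minus_push => //; exact: KG.
Qed.

Lemma ctm_differentiable : differentiable_map f.
Proof. exact: C1_differentiable (ctm_C1 ctf). Qed.

Lemma ctm_inverse_differentiable : differentiable_map g.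
Proof. exact: C1_differentiable (ctm_inverse_C1 ctf). Qed.

Definition averages (s : A -> R) x := [/\ K x,
    n%:R^-1 * birkhoff_sum f (fun y => ln (stretch f s y)) n x @[n --> \oo] -->
      mean_log_stretch s
  & n%:R^-1 * birkhoff_sum g (fun y => ln (stretch f s (g y))^-1) n x @[n --> \oo] --> -
    mean_log_stretch s].

Lemma invariant_slope_averages s : invariant_slope s -> {ae mu, forall x, averages s x}.
Proof. by move=> [ms sge sle spush]; exact: log_stretch_averages. Qed.

Lemma growth_rateE x v l : growth_rate f x v l <->
  n%:R^-1 * ln `|v *m Df (iter n f) x| @[n --> \oo] --> l /\
  n%:R^-1 * ln `|v *m Df (iter n g) x| @[n --> \oo] --> - l.
Proof.
rewrite /growth_rate.
have -> : (fun n : nat => - n%:R^-1 * ln `|v *m Df (iterz f (- n%:Z)) x|) =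
          (fun n => - (n%:R^-1 * ln `|v *m Df (iter n g) x|)).
  apply/funext => n; rewrite mulNr (_ : iterz f (- n%:Z) = iter n g) //.
  by apply/funext => y; exact: iterzN.
by split=> -[h1 /cvg_oppE h2].
Qed.

Lemma invariant_slope_bounded s : invariant_slope s -> exists C, forall x, K x -> `|s x| <=
  C.
Proof. by move=> [_ sge sle _]; exact: s_bounded. Qed.

Lemma invariant_slope_stretch_gt0 s : invariant_slope s -> forall x, K x -> 0 < stretch f s
  x.
Proof. by move=> [_ sge _ _] x; exact: stretch_gt0. Qed.

Lemma invariant_slope_shrink_gt0 s : invariant_slope s ->
  forall x, K x -> 0 < (stretch f s (g x))^-1.
Proof.
by move=> sI x Kx; rewrite invr_gt0; apply: (invariant_slope_stretch_gt0 sI);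
  exact: (supp_g x).2.
Qed.

Lemma invariant_slope_pull s : invariant_slope s -> forall x, K x ->
  line (s x) *m Df g x = (stretch f s (g x))^-1 *: line (s (g x)).
Proof. by move=> [_ sge _ sp] x; exact: line_pull. Qed.

Lemma invariant_slope_push s : invariant_slope s -> forall x, K x ->
  line (s x) *m Df f x = stretch f s x *: line (s (f x)).
Proof. by move=> [_ _ _ sp]. Qed.

Lemma line_growth_rate s x c : invariant_slope s -> averages s x -> c != 0 ->
  growth_rate f x (c *: line (s x)) (mean_log_stretch s).
Proof.
move=> sI [Kx a1 a2] c0; have [C sC] := invariant_slope_bounded sI.
apply/growth_rateE; split.
  exact: (line_growth ctm_differentiable (fun x => (supp_f x).2)
    (invariant_slope_stretch_gt0 sI) sC
    (invariant_slope_push sI) Kx c0 a1).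
exact: (line_growth ctm_inverse_differentiable (fun x => (supp_g x).2)
  (invariant_slope_shrink_gt0 sI) sC
  (invariant_slope_pull sI) Kx c0 a2).
Qed.

(** The slopes s_(-n) test the forward rate and the slopes s_n the backward one; both converge to
    [s x] at this one point, which is enough as the mean does not depend on it. *)
Lemma mean_log_stretch_eq0 s x : invariant_slope s -> averages s x ->
  s x = s_minus f x -> s x = s_plus f x -> mean_log_stretch s = 0.
Proof.
move=> sI [Kx a1 a2] sm sp; have [C sC] := invariant_slope_bounded sI.
have [cp cm _ _ _] := Green_limits (KG Kx).
rewrite -sm in cm; rewrite -sp in cp.
have [M1 f10] := Df_f_bound; have [M2 g10] := Df_g_bound.
have le1 : mean_log_stretch s <= 0.
  apply: (invariant_rate_le0 ctm_differentiable (fun x => (supp_f x).2)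
    (invariant_slope_stretch_gt0 sI)
    (invariant_slope_push sI) (fun x _ => ctm_det ctf x) (fun x _ => f10 x) Kx a1 cm).
  move=> [//|n] _; have n0 : - n.+1%:Z != 0 by [].
  exact: (slope_iterz ctf (KG Kx) n0).
have le2 : - mean_log_stretch s <= 0.
  apply: (invariant_rate_le0 ctm_inverse_differentiable (fun x => (supp_g x).2)
    (invariant_slope_shrink_gt0 sI)
    (invariant_slope_pull sI) (fun x _ => Df_g_det ctf x) (fun x _ => g10 x) Kx a2 cp).
  move=> [//|n] _; have n0 : n.+1%:Z != 0 by [].
  exact: (slope_iterz ctf (KG Kx) n0).
by apply/eqP; rewrite eq_le le1 -oppr_le0.
Qed.

Lemma growth_rate0 s x v : invariant_slope s -> averages s x -> mean_log_stretch s = 0 ->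
  v != 0 -> growth_rate f x v 0.
Proof.
move=> sI [Kx a1 a2] m0 v0; have [C sC] := invariant_slope_bounded sI.
rewrite m0 in a1 a2; rewrite oppr0 in a2.
have [M1 f10] := Df_f_bound; have [M2 g10] := Df_g_bound.
apply/growth_rateE; rewrite oppr0; split.
  exact: (invariant_rate0 ctm_differentiable (fun x => (supp_f x).2)
    (invariant_slope_stretch_gt0 sI) sC
    (invariant_slope_push sI) (fun x _ => ctm_det ctf x) (fun x _ => f10 x) Kx v0 a1).
exact: (invariant_rate0 ctm_inverse_differentiable (fun x => (supp_g x).2)
  (invariant_slope_shrink_gt0 sI) sC
  (invariant_slope_pull sI) (fun x _ => Df_g_det ctf x) (fun x _ => g10 x) Kx v0 a2).
Qed.

(** The sum of the two rates is nonnegative for [f], and so is its opposite, which is the sum for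
    the inverse. *)
Lemma mean_log_stretch_opp s t x : invariant_slope s -> invariant_slope t ->
  averages s x -> averages t x -> t x < s x ->
  mean_log_stretch t = - mean_log_stretch s.
Proof.
move=> sI tI [Kx s1 s2] [_ t1 t2] ts.
have [C sC] := invariant_slope_bounded sI; have [D tD] := invariant_slope_bounded tI.
have C' y : K y -> `|s y| <= Num.max C D by move=> Ky; rewrite le_max sC.
have D' y : K y -> `|t y| <= Num.max C D by move=> Ky; rewrite le_max tD ?orbT.
have ge1 := two_lines_rate_ge0 (fun x => (supp_f x).2) (invariant_slope_stretch_gt0 sI)
  (invariant_slope_stretch_gt0 tI) C' D' (invariant_slope_push sI) (invariant_slope_push tI)
  (fun x _ => ctm_det ctf x) Kx ts s1 t1.
have ge2 := two_lines_rate_ge0 (fun x => (supp_g x).2) (invariant_slope_shrink_gt0 sI)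
  (invariant_slope_shrink_gt0 tI) C' D' (invariant_slope_pull sI) (invariant_slope_pull tI)
  (fun x _ => Df_g_det ctf x) Kx ts s2 t2.
lra.
Qed.

(** Written as a level set of a difference and cut by the support, where both slopes are
    measurable. *)
Definition collapsed : set bA := K `&` [set x | s_plus f x - s_minus f x = 0].

Lemma measurable_collapsed : measurable collapsed.
Proof.
have [mp _ _ _] := invariant_slope_plus; have [mm _ _ _] := invariant_slope_minus.
have mB := measurable_funB mp mm measurable_supp (measurable_set1 (0 : R)).
exact mB.
Qed.

Lemma scale_line_inj (a b s t : R) : a != 0 -> a *: line s = b *: line t -> s = t.
Proof.
move=> a0 E.
have E0 := congr1 (fun v : 'rV[R]_2 => v 0 0) E; have E1 := congr1 (fun v : 'rV[R]_2 => v 0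
  1) E.
move: E0 E1; rewrite /= !rowZE !line00 !line01 !mulr1 => <-.
exact: mulfI.
Qed.

(** [Df] and its inverse carry both invariant lines along, so the lines coincide at [x] exactly when
    they do at [f x]. *)
Lemma collapsed_invariant : f @^-1` collapsed = collapsed.
Proof.
have pI := invariant_slope_plus; have mI := invariant_slope_minus.
apply/seteqP; split=> x [Kx /eqP]; rewrite subr_eq0 => /eqP E.
  have Kx' := (supp_f x).1 Kx; split; first exact: Kx'.
  have := invariant_slope_pull pI Kx; have := invariant_slope_pull mI Kx.
  rewrite -E (ctm_fK ctf) => -> /esym Epm; apply/eqP; rewrite subr_eq0; apply/eqP.
  apply: scale_line_inj Epm.
  by rewrite gt_eqF// invr_gt0; exact: (invariant_slope_stretch_gt0 pI).
split; first exact: (supp_f x).2.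
have := invariant_slope_push pI Kx; have := invariant_slope_push mI Kx.
rewrite -E => -> /esym Epm; apply/eqP; rewrite subr_eq0; apply/eqP.
by apply: scale_line_inj Epm; rewrite gt_eqF//; exact: (invariant_slope_stretch_gt0 pI).
Qed.
End support_in_Green.

Lemma gt_opp_gt0 (R : realType) (x : R) : - x < x -> 0 < x.
Proof. by lra. Qed.

Lemma half_double (R : realType) (x : R) : 1 / 2 * (x + x) = x.
Proof. by lra. Qed.

(** * Lyapunov exponents *)

Section lines.
Context (R : realType).

Lemma line_neq0 (s : R) : line s != 0.
Proof.
apply/eqP => /(congr1 (fun v : 'rV[R]_2 => v 0 0)); rewrite /= line00 mxE => /eqP.
by rewrite oner_eq0.
Qed.

Lemma rank_line (s : R) : \rank (line s) = 1%N.
Proof. by rewrite rank_rV line_neq0. Qed.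

Lemma line_cap0 (s t : R) : s != t -> (line s :&: line t)%MS = 0.
Proof.
move=> st; apply/eqP/rowV0P => v; rewrite sub_capmx => /andP[/sub_rVP[a ->] /sub_rVP[b E]].
apply/eqP; rewrite scaler_eq0 (negPf (line_neq0 s)) orbF; apply: contraNT st => a0.
by rewrite (scale_line_inj a0 E).
Qed.

Lemma green_dim1 f (x : annulus R) : s_plus f x = s_minus f x -> green_dim f x = 1%N.
Proof.
move=> E; rewrite /green_dim /G_minus /G_plus E.
by rewrite (capmx_idPl (submx_refl _)) rank_line.
Qed.

Lemma green_dim0 f (x : annulus R) : s_minus f x < s_plus f x -> green_dim f x = 0%N.
Proof. by move=> E; rewrite /green_dim /G_minus /G_plus line_cap0 ?mxrank0// lt_eqF. Qed.

Lemma oseledets_zero f (x : annulus R) : (forall v, v != 0 -> growth_rate f x v 0) ->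
  exists E : R -> 'M[R]_2,
    [/\ forall l, l \in [:: 0 : R] -> E l != 0,
        (\sum_(l <- [:: 0 : R]) E l :=: 1%:M)%MS,
        mxdirect (\sum_(l <- [:: 0 : R]) E l)%MS
      & forall l (v : 'rV[R]_2), l \in [:: 0 : R] -> (v <= E l)%MS -> v != 0 ->
          growth_rate f x v l].
Proof.
move=> gr; exists (fun=> 1%:M); split.
- by move=> _ _; exact: oner_neq0.
- by rewrite big_seq1.
- by rewrite mxdirectE /= !big_seq1.
- by move=> l v; rewrite inE => /eqP -> _; exact: gr.
Qed.

Lemma oseledets_lines f (x : annulus R) (l s t : R) : - l < l -> s != t ->
  (forall c, c != 0 -> growth_rate f x (c *: line s) l) ->
  (forall c, c != 0 -> growth_rate f x (c *: line t) (- l)) ->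
  exists E : R -> 'M[R]_2,
    [/\ forall m, m \in [:: - l; l] -> E m != 0,
        (\sum_(m <- [:: - l; l]) E m :=: 1%:M)%MS,
        mxdirect (\sum_(m <- [:: - l; l]) E m)%MS
      & forall m (v : 'rV[R]_2), m \in [:: - l; l] -> (v <= E m)%MS -> v != 0 ->
          growth_rate f x v m].
Proof.
(* [<<_>>] turns a row vector into a square matrix with the same row space; the test separates the
   two exponents because [- l < l]. *)
move=> ll st gs gt; pose E (m : R) : 'M[R]_2 := if m == l then <<line s>>%MS else <<line
  t>>%MS.
have El : E l = <<line s>>%MS by rewrite /E eqxx.
have EN : E (- l) = <<line t>>%MS by rewrite /E lt_eqF.
have rk m : \rank (E m) = 1%N by rewrite /E; case: ifP => _; rewrite mxrank_gen rank_line.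
have sum_rank : \rank (\sum_(m <- [:: - l; l]) E m)%MS = 2%N.
  rewrite big_cons big_seq1 El EN.
  have -> : \rank (<<line t>> + <<line s>>)%MS = \rank (line t + line s)%MS.
    by rewrite (adds_eqmx (genmxE _) (genmxE _)).
  have := mxrank_sum_cap (line t) (line s).
  by rewrite line_cap0 1?eq_sym// mxrank0 addn0 !rank_line.
exists E; split.
- by move=> m _; rewrite -mxrank_eq0 rk.
- by apply/eqmxP; rewrite submx1 sub1mx /row_full sum_rank eqxx.
- by rewrite mxdirectE /= sum_rank !big_cons big_nil /= !rk.
move=> m v; rewrite !inE => /orP[] /eqP ->; rewrite ?El ?EN genmxE => /sub_rVP[c ->];
  rewrite scaler_eq0 negb_or => /andP[c0 _]; [exact: gt|exact: gs].
Qed.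
End lines.

Section final.
Context (R : realType).
Notation A := (annulus R).
Notation bA := (borel_annulus R).
Variables (f : A -> A) (mu : probability bA R).
Hypothesis ctf : conservative_twist_map f.
Hypothesis finv : invariant_measure f mu.
Hypothesis ferg : ergodic_measure f mu.
Hypothesis cK : compact (measure_supp mu).
Hypothesis KG : measure_supp mu `<=` Green f.
Local Notation K := (measure_supp mu).
Local Notation averages := (averages f mu).
Local Notation mean := (mean_log_stretch f mu).

Lemma averages_plus : {ae mu, forall x, averages (s_plus f) x}.
Proof.
exact: (invariant_slope_averages ctf finv ferg cK KG (invariant_slope_plus ctf KG)).
Qed.

Lemma averages_minus : {ae mu, forall x, averages (s_minus f) x}.
Proof.
exact: (invariant_slope_averages ctf finv ferg cK KG (invariant_slope_minus ctf KG)).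
Qed.

Lemma collapsed_exponents : mu (collapsed f mu) = 1%E -> lyapunov_exponents f mu [:: 0].
Proof.
move=> B1; have mB := measurable_collapsed ctf KG.
have sI := invariant_slope_plus ctf KG.
split; first by [].
(* A set of full measure is nonempty, and one point evaluates the constant mean. *)
have [x0 [[a0 _] B0]] : exists x, (averages (s_plus f) x /\ averages (s_plus f) x) /\
  collapsed f mu x.
  apply: (@ae_exists _ _ _ mu); apply: (ae_imply3 averages_plus averages_plus
    (probability1_ae mB B1)).
  by move=> x a b c.
have m0 : mean (s_plus f) = 0.
  case: B0 => Kx /eqP; rewrite subr_eq0 => /eqP E.
  exact: (mean_log_stretch_eq0 ctf finv cK KG sI a0 E).
apply: (ae_imply averages_plus) => x ax; apply: oseledets_zero => v.
exact: (growth_rate0 ctf finv cK KG sI ax m0).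
Qed.

Lemma not_collapsed_ae : mu (collapsed f mu) = 0%E ->
  {ae mu, forall x, K x -> s_minus f x < s_plus f x}.
Proof.
move=> B0; exists (collapsed f mu); split; [exact: (measurable_collapsed ctf KG)|exact:
  B0|].
move=> x /= /not_implyP[Kx /negP]; rewrite -leNgt => h; split; first exact: Kx.
have [_ _ _ h' _] := Green_limits (KG Kx).
by apply/eqP; rewrite subr_eq0 eq_le h h'.
Qed.

Lemma integral_log_quotient :
  (\int[mu]_(x in K) (ln (stretch f (s_plus f) x / stretch f (s_minus f) x))%:E)%E =
  (mean (s_plus f) - mean (s_minus f))%:E.
Proof.
have pI := invariant_slope_plus ctf KG; have mI := invariant_slope_minus ctf KG.
have [mp pge ple _] := pI; have [mm mge mle _] := mI.
have [C pC] := log_stretch_bounded ctf cK KG pge ple.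
have [D mD] := log_stretch_bounded ctf cK KG mge mle.
have ip := @bounded_integrable _ _ bA mu _ _ (measurable_log_stretch ctf KG mp) pC.
have im := @bounded_integrable _ _ bA mu _ _ (measurable_log_stretch ctf KG mm) mD.
have iB : mu.-integrable setT (EFin \o (log_stretch f mu (s_plus f) \- log_stretch f mu
  (s_minus f))).
  exact: (integrableB measurableT ip im).
have -> : (mean (s_plus f) - mean (s_minus f))%:E =
    (\int[mu]_x (log_stretch f mu (s_plus f) x - log_stretch f mu (s_minus f) x)%:E)%E.
  rewrite /mean_log_stretch -(RintegralB measurableT ip im) fineK; first exact: erefl.
  exact: (integrable_fin_num measurableT iB).
(* Both extended logarithms vanish off the support, so the integral over it is one over the whole
   space. *)
rewrite [LHS]integral_mkcond; apply: eq_integral => x _.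
rewrite patchE; case: ifPn => [|nK].
  rewrite inE => Kx; rewrite !(log_stretchE _ _ Kx) ln_div; first exact: erefl.
    by rewrite posrE; exact: (invariant_slope_stretch_gt0 ctf KG pI Kx).
  by rewrite posrE; exact: (invariant_slope_stretch_gt0 ctf KG mI Kx).
have {}nK : ~ K x by move=> Kx; move/negP: nK; apply; rewrite inE.
rewrite !(log_stretch_out _ _ nK) subrr; exact: erefl.
Qed.

Lemma log_stretch_lt x : K x -> s_minus f x < s_plus f x ->
  log_stretch f mu (s_minus f) x < log_stretch f mu (s_plus f) x.
Proof.
move=> Kx sx; rewrite !(log_stretchE _ _ Kx) ltr_ln.
- by rewrite ltr_pM2l ?twist_gt0// ltrD2r.
- by rewrite posrE; exact: (invariant_slope_stretch_gt0 ctf KG (invariant_slope_minus ctf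
  KG) Kx).
- by rewrite posrE; exact: (invariant_slope_stretch_gt0 ctf KG (invariant_slope_plus ctf
  KG) Kx).
Qed.

Lemma log_stretch_le x : log_stretch f mu (s_minus f) x <= log_stretch f mu (s_plus f) x.
Proof.
have [Kx|nK] := pselect (K x); last by rewrite !(log_stretch_out _ _ nK).
have [_ _ _ h _] := Green_limits (KG Kx).
move: h; rewrite le_eqVlt => /orP[/eqP E|/(log_stretch_lt Kx)/ltW//].
by rewrite !(log_stretchE _ _ Kx) /stretch E.
Qed.

(** The difference of the logarithms is nonnegative everywhere; were its integral not positive, it
    would vanish almost everywhere, whereas it is positive almost everywhere. *)
Lemma mean_log_stretch_lt : mu (collapsed f mu) = 0%E -> mean (s_minus f) < mean (s_plus f).
Proof.
move=> B0; rewrite ltNge; apply/negP => le.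
have pI := invariant_slope_plus ctf KG; have mI := invariant_slope_minus ctf KG.
have [mp pge ple _] := pI; have [mm mge mle _] := mI.
have [C pC] := log_stretch_bounded ctf cK KG pge ple.
have [D mD] := log_stretch_bounded ctf cK KG mge mle.
have mlp := measurable_log_stretch ctf KG mp; have mlm := measurable_log_stretch ctf KG mm.
have ip := @bounded_integrable _ _ bA mu _ _ mlp pC.
have im := @bounded_integrable _ _ bA mu _ _ mlm mD.
pose F := fun x : bA => log_stretch f mu (s_plus f) x - log_stretch f mu (s_minus f) x.
have F0 x : 0 <= F x by rewrite subr_ge0; exact: log_stretch_le.
have mF : measurable_fun setT F := measurable_funB mlp mlm.
have FC x : `|F x| <= C + D by rewrite (le_trans (ler_normB _ _))// lerD.
have iF := @bounded_integrable _ _ bA mu _ _ mF FC.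
have RF : \int[mu]_x (F x) = 0.
  apply/eqP; rewrite eq_le; apply/andP; split; last by apply: Rintegral_ge0 => x _;
    exact: F0.
  by rewrite (RintegralB measurableT ip im) subr_le0.
have EF : (\int[mu]_x `|(F x)%:E| = 0)%E.
  transitivity (\int[mu]_x (F x)%:E)%E.
    by apply: eq_integral => x _; rewrite gee0_abs// lee_fin.
  rewrite -(fineK (integrable_fin_num measurableT iF)).
  exact: (congr1 EFin RF).
have /(ae_eq_integral_abs mu measurableT) aeF : measurable_fun setT (EFin \o F).
  exact/measurable_EFinP.
have B0' : {ae mu, forall x, [set: bA] x -> (F x)%:E = 0%E} by exact: (aeF.1 EF).
have [x [Kx sx Fx]] : exists x, [/\ K x, s_minus f x < s_plus f x & F x = 0].
  apply: (@ae_exists _ _ _ mu).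
  apply: (ae_imply3 (measure_supp_full mu) (not_collapsed_ae B0) B0') => x Kx sx Fx.
  split; [exact: Kx|exact: sx|].
  by have [] := Fx I.
by have := log_stretch_lt Kx sx; rewrite -subr_gt0 -/(F x) Fx ltxx.
Qed.
End final.

Theorem theorem8 (R : realType) (f : annulus R -> annulus R)
    (mu : probability (borel_annulus R) R) :
  conservative_twist_map f ->
  invariant_measure f mu ->
  ergodic_measure f mu ->
  compact (measure_supp mu) ->
  measure_supp mu `<=` Green f ->
  exists d : nat,
    [/\ {ae mu, forall x, green_dim f x = d},
        d = 0%N ->
          hyperbolic f mu /\
          exists l : R,
            [/\ - l < l,
                lyapunov_exponents f mu [:: - l; l],
                l%:E = ((1 / 2)%:E * \int[mu]_(x in measure_supp mu)
                  (ln ((s_plus f x - slope f (-1) x)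
                       / (s_minus f x - slope f (-1) x)))%:E)%E
              & l%:E = ((1 / 2)%:E * \int[mu]_(x in measure_supp mu)
                  (ln (1 + (s_plus f x - s_minus f x)
                           / (s_minus f x - slope f (-1) x)))%:E)%E]
      & d = 1%N -> lyapunov_exponents f mu [:: 0]].
Proof.
move=> ctf finv ferg cK KG.
have pI := invariant_slope_plus ctf KG; have mI := invariant_slope_minus ctf KG.
have ap := averages_plus ctf finv ferg cK KG; have am := averages_minus ctf finv ferg cK KG.
have mB := measurable_collapsed ctf KG.
(* Ergodicity makes the dimension constant: it is 1 when the set of collapsed points has full
   measure and 0 when that set is null. *)
have [B0|B1] := ferg _ mB (collapsed_invariant ctf finv KG); last first.
  exists 1%N; split=> // [|_]; last exact: (collapsed_exponents ctf finv ferg cK KG B1).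
  apply: (ae_imply (probability1_ae mB B1)) => x [_ /eqP].
  by rewrite subr_eq0 => /eqP; exact: green_dim1.
have nc := not_collapsed_ae ctf KG B0.
have ae_all : {ae mu, forall x, [/\ averages f mu (s_plus f) x, averages f mu (s_minus f) x
    & s_minus f x < s_plus f x]}.
  by apply: (ae_imply3 ap am nc) => x a1 a2 h; have [Kx _ _] := a1; split; [|
    |exact: h].
have opp : mean_log_stretch f mu (s_minus f) = - mean_log_stretch f mu (s_plus f).
  have [x [a1 a2 sx]] := ae_exists ae_all.
  exact: (mean_log_stretch_opp ctf finv cK KG pI mI a1 a2 sx).
have [l lE0] : exists l, mean_log_stretch f mu (s_plus f) = l by exists (mean_log_stretch f
  mu (s_plus f)).
rewrite lE0 in opp.
have ll : - l < l.
  have lt := mean_log_stretch_lt ctf cK KG B0; rewrite opp lE0 in lt; exact: lt.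
have l0 := gt_opp_gt0 ll.
have lyap : lyapunov_exponents f mu [:: - l; l].
  split; first by rewrite /= inE andbT lt_eqF.
  apply: (ae_imply ae_all) => x [a1 a2 sx].
  apply: (oseledets_lines (s := s_plus f x) (t := s_minus f x) ll) => [|c c0|c c0].
  - by rewrite gt_eqF.
  - by rewrite -lE0; exact: (line_growth_rate ctf finv cK KG pI a1 c0).
  - by rewrite -opp; exact: (line_growth_rate ctf finv cK KG mI a2 c0).
(* The integral is the difference [l - (- l)] of the means, which explains the factor 1 / 2. *)
have lE : l%:E = ((1 / 2)%:E * \int[mu]_(x in measure_supp mu)
    (ln (stretch f (s_plus f) x / stretch f (s_minus f) x))%:E)%E.
  have IQ := integral_log_quotient ctf cK KG; rewrite opp lE0 opprK in IQ.
  rewrite -[l in LHS](half_double l) EFinM; congr (_ * _)%E; exact (esym IQ).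
have quotientE x : measure_supp mu x ->
    (s_plus f x - slope f (-1) x) / (s_minus f x - slope f (-1) x) =
    stretch f (s_plus f) x / stretch f (s_minus f) x.
  move=> Kx; rewrite /stretch -mulf_div divff ?mul1r//.
  by rewrite gt_eqF// twist_gt0.
exists 0%N; split=> // [|_].
  by apply: (ae_imply ae_all) => x [_ _]; exact: green_dim0.
split; first by exists (- l), l; split; [rewrite oppr_lt0 l0|].
exists l; split => //; rewrite lE; congr (_ * _)%E; apply: eq_integral => x;
  rewrite inE => Kx; rewrite -quotientE//.
have d0 : s_minus f x - slope f (-1) x != 0.
  by rewrite subr_eq0 gt_eqF//; exact: (s_minus_gt (KG _ Kx)).
by congr (ln _)%:E; field.
Qed.
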